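(* Suppose that the essential supremum of $v(0)$ is $\infty$ and that $\mu[v(0)>x]=\exp\{-h(x)\}$ for $x>0$, where $h$ is regularly varying at infinity with index $\rho$ for some $1<\rho<\infty$. Let $$\gamma_1=\frac1{\rho-1},\qquad \gamma_2=2^{\frac{\rho}{\rho-1}}\frac{1}{\rho-1},\qquad J(t)=H(t).$$ Then: (a) for all $\theta\neq 0$ with $|\theta|$ small enough, $\lim_{t\to\infty}\frac{F_{2\theta}(t)-F_\theta(t)}{\theta\log t}=\infty$; (b) there are increasing functions $f_1,f_2:\mathbb R\setminus\{0\}\to\mathbb R$ such that for all $\theta\ne0$ with $|\theta|$ small enough, $F_\theta(t)\sim f_1(\theta)J(t)$ and $F_\theta(2t)\sim f_2(\theta)J(t)$ as $t\to\infty$; (c) $\lim_{\theta\to0}f_1(\theta)=\gamma_1$ and $\lim_{\theta\to0}f_2(\theta)=\gamma_2$.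
   Context: Fix $d\ge 1$ and $\kappa\ge 0$. A field configuration is $w=(w(x))_{x\in\mathbb Z^d}$ with $w(x)=(v_-(x),v_+(x))\in[0,\infty]\times[0,\infty)$. Given $w$, consider non-interacting particles on $\mathbb Z^d$: each particle performs, independently, a continuous-time simple symmetric random walk of total jump rate $2d\kappa$ (rate $\kappa$ to each nearest neighbour); a particle at $x$ is replaced by two independent particles at $x$ at rate $v_+(x)$ and is annihilated at rate $v_-(x)$, where $v_-(x)=\infty$ means instantaneous annihilation (a particle started at such a site contributes nothing for $t>0$). The process is the increasing limit as $n\to\infty$ of the processes in which particles leaving $\{x:\|x\|_\infty\le n\}$ are removed. Let $\zeta(t)$ be the total number of particles at time $t$ and $E_x^w$ the expectation when there is initially exactly one particle, at $x$. The quenched first moment is $m(x,t,w)=E^w_x[\zeta(t)]$. The environment is random: $\mu$ is a probability measure under which the $w(x)$, $x\in\mathbb Z^d$, are i.i.d.; $\langle\cdot\rangle$ denotes expectation under $\mu$. Put $v(x)=v_+(x)-v_-(x)\in[-\infty,\infty)$ (effective potential, with $e^{-\infty}=0$). Standing assumption: $\mu[v(0)=-\infty]<1$ and $\langle e^{v(0)t}\rangle<\infty$ for all $t\ge0$. Define $H(t)=\log\langle e^{v(0)t}\rangle$ and $H_1(t)=\log\langle m(0,t)\rangle$ for $t\ge0$ and, for $\theta\ne0$ with $1+\theta\ge 0$, $$F_\theta(t)=\frac{H_1((1+\theta)t)-(1+\theta)H_1(t)}{\theta}.$$ A function $h$ is regularly varying at infinity with index $\rho$ if $\lim_{x\to\infty}h(ax)/h(x)=a^\rho$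 for every $a>0$. The notation $f\sim g$ means $f(t)/g(t)\to1$ as $t\to\infty$. *)

(* Defs.v *)
From HB Require Import structures.
From mathcomp Require Import all_boot all_order all_algebra finmap.
From mathcomp Require Import all_classical all_reals all_analysis.
From mathcomp Require Import measurable_realfun ess_sup_inf.

Set Implicit Arguments.
Unset Strict Implicit.
Unset Printing Implicit Defensive.
Import Order.TTheory GRing.Theory Num.Theory numFieldNormedType.Exports.

Local Open Scope classical_set_scope.
Local Open Scope ring_scope.

Definition Zd (d : nat) := 'rV[int]_d.

(* A field configuration: w x = (v_-(x), v_+(x)). That the values lie in
   [0, +oo] x [0, +oo) is the separate condition [field_range]. *)
Definition field (R : realType) (d : nat) := Zd d -> (\bar R * R)%type.

Definition field_range (R : realType) (d : nat) (w : field R d) : Prop :=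
  forall x, (0 <= (w x).1)%E /\ 0 <= (w x).2.

Section BranchingRandomWalk.
Context (R : realType) (d : nat) (kappa : R).
Implicit Types (w : field R d) (x y : Zd d) (n k : nat) (t : R).

Definition neighbours x : seq (Zd d) :=
  [seq x + delta_mx 0 i | i <- enum 'I_d] ++
  [seq x - delta_mx 0 i | i <- enum 'I_d].

Definition in_box n x : bool := [forall i, `|x 0 i| <= n%:Z].

(* The sites on which particles survive for a positive time in the process
   killed outside the box of radius n. *)
Definition alive n w x : bool := in_box n x && ((w x).1 < +oo)%E.

(* The state of the particle system: the list of the particles' positions. *)
Definition config := seq (Zd d).

(* What a single particle at x can turn into, with the corresponding rates:
   two particles at x, nothing, or one particle at a neighbouring site, which is
   removed at once if that site is outside the box or has v_- = +oo.
   States consist of alive sites only, so [fine] never meets +oo. *)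
Definition particle_events n w x : seq (R * config) :=
  (((w x).2, [:: x; x]) : R * config) ::
  ((fine (w x).1, [::]) : R * config) ::
  [seq (kappa, [seq z <- [:: y] | alive n w z]) | y <- neighbours x].

(* The particles evolve independently: each event affects one of them. *)
Definition jumps n w (s : config) : seq (R * config) :=
  [seq (e.1, take i s ++ e.2 ++ drop i.+1 s)
     | i <- iota 0 (size s), e <- particle_events n w (nth 0 s i)].

Definition exit_rate n w (s : config) : R := \sum_(e <- jumps n w s) e.1.

(* Probability that the Markov jump process started from s is in state s' at
   time t after having made at most k jumps. The first jump occurs at an
   exponential time u of parameter [exit_rate n w s], and the state after it is
   chosen with probability proportional to the rates. *)
Fixpoint transition_upto n w k t (s s' : config) : \bar R :=
  ((expR (- exit_rate n w s * t) * (s == s')%:R)%:E +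
   if k is k'.+1 then
     \int[lebesgue_measure]_(u in `[0%R, t])
       ((expR (- exit_rate n w s * u))%:E *
        \sum_(e <- jumps n w s) e.1%:E * transition_upto n w k' (t - u) e.2 s')
   else 0)%E.

Definition transition n w t (s s' : config) : \bar R :=
  ereal_sup (range (fun k => transition_upto n w k t s s')).

(* One particle at x; if the site is not alive, the particle is present at
   time 0 only. *)
Definition initial_config n w x t : config :=
  if t == 0 then [:: x] else [seq z <- [:: x] | alive n w z].

(* Expected number of particles at time t in the box of radius n. *)
Definition first_moment_box n w x t : \bar R :=
  (\esum_(s in [set: config])
    ((size s)%:R%:E * transition n w t (initial_config n w x t) s))%E.

(* The process is the increasing limit of the processes in boxes, so its
   expectation is the supremum of theirs. *)
Definition first_moment w x t : \bar R :=
  ereal_sup (range (fun n => first_moment_box n w x t)).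

End BranchingRandomWalk.

Definition potential (R : realType) (d : nat) (w : field R d) (x : Zd d) :
    \bar R :=
  ((w x).2%:E - (w x).1)%E.

Section Environment.
Context (R : realType) (d : nat) (disp : measure_display)
  (T : measurableType disp) (mu : probability T R).
Variable w : Zd d -> {RV mu >-> (\bar R * R)%type}.

Definition sample (o : T) : field R d := fun x => w x o.

Definition identically_distributed : Prop :=
  forall x (A : set (\bar R * R)), measurable A ->
    distribution mu (w x) A = distribution mu (w 0) A.

Definition independent_sites : Prop :=
  forall (S : {fset Zd d}) (A : Zd d -> set (\bar R * R)),
    (forall x, measurable (A x)) ->
    mu (\bigcap_(x in [set` S]) (w x @^-1` A x)) =
    (\prod_(x <- S) mu (w x @^-1` A x))%E.

Definition iid_environment : Prop :=
  identically_distributed /\ independent_sites.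

Definition v0 (o : T) : \bar R := potential (sample o) 0.

Definition mean_exp (t : R) : \bar R := (\int[mu]_o expeR (v0 o * t%:E))%E.

Definition mean_first_moment (kappa : R) (t : R) : \bar R :=
  (\int[mu]_o first_moment kappa (sample o) 0%R t)%E.

Definition H (t : R) : R := ln (fine (mean_exp t)).

Definition H1 (kappa : R) (t : R) : R := ln (fine (mean_first_moment kappa t)).

Definition F (kappa : R) (theta t : R) : R :=
  (H1 kappa ((1 + theta) * t) - (1 + theta) * H1 kappa t) / theta.

End Environment.

Definition regularly_varying (R : realType) (h : R -> R) (rho : R) : Prop :=
  forall a : R, 0 < a -> h (a * x) / h x @[x --> +oo] --> a `^ rho.

Definition asymp_equiv (R : realType) (f g : R -> R) : Prop :=
  f t / g t @[t --> +oo] --> (1 : R).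

Definition increasing_off0 (R : realType) (f : R -> R) : Prop :=
  forall a b : R, a != 0 -> b != 0 -> a < b -> f a < f b.

(* Main.v *)
(* The averaged first moment satisfies
   exp(H t - 2 d kappa t) <= <m(0,t)> <= exp(H t). The lower bound follows the
   particles that never leave the origin, in the box reduced to one site. For the
   upper bound, the quenched moment is dominated by the Feynman-Kac solution of
   the parabolic Anderson problem; expanded over the paths of the walk, this is
   at most an average of exp(t v(y)) over the sites y visited, by convexity of
   exp, and every site has mean exp(H t) because the v(y) are identically
   distributed. All comparisons are between solutions of linear differential
   equations in t, solved recursively in the number of jumps.

   Since H is, up to lower order terms, the Legendre transform of h, it is
   regularly varying with index b = rho / (rho - 1) > 1, and H t / t tends to
   infinity, so H1 ~ H. Hence F_theta(t) / H(t) tends to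
   ((1 + theta)^b - (1 + theta)) / theta. This is the slope of the chord of the
   strictly convex function x^b between 1 and 1 + theta, minus 1; it increases
   with theta and tends to b - 1 as theta tends to 0. *)
Require Import Defs.
From mathcomp Require Import all_boot all_order all_algebra finmap.
From mathcomp Require Import all_classical all_reals all_analysis.
From mathcomp Require Import measurable_realfun ess_sup_inf.
From mathcomp Require Import zify ring lra.
Import Order.TTheory GRing.Theory Num.Theory numFieldNormedType.Exports.
Local Open Scope classical_set_scope.
Local Open Scope ring_scope.

(** * Linear differential equations *)

(** The integral of a nonnegative function is a supremum over simple functions below it, hence
    monotone for arbitrary functions. It serves for [first_moment] as a function of the environment,
    controlled only by pointwise bounds. *)
Lemma le_integral_setT_nonmeasurable (d : measure_display) (T : measurableType d)
    (R : realType) (mu : {measure set T -> \bar R}) (f g : T -> \bar R) :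
  (forall x, (0 <= f x)%E) -> (forall x, (f x <= g x)%E) ->
  (\int[mu]_x f x <= \int[mu]_x g x)%E.
Proof.
move=> f0 fg; have g0 x : (0 <= g x)%E by exact: le_trans (f0 x) (fg x).
rewrite !ge0_integralTE//; apply: ge_ereal_sup => _ [h hf <-].
by apply: ereal_sup_ubound; exists h => // x; exact: le_trans (hf x) (fg x).
Qed.

Lemma continuous_primitive_right (R : realType) (g : R -> R) :
  continuous g ->
  exists G : R -> R, forall t : R, -1 < t -> is_derive t 1 G (g t).
Proof.
move=> cg.
exists (fun x => \int[lebesgue_measure]_(t in `[(-1 : R), x]) g t) => t t1.
have tt1 : t < t + 1 by rewrite ltrDl.
have [|dG <-] := @continuous_FTC1_closed _ g (-1) t (t + 1) tt1 _ t1 (cg t).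
  apply: continuous_compact_integrable; first exact: segment_compact.
  by apply: continuous_subspaceT.
by rewrite derive1E; exact: derivableP.
Qed.

Lemma is_derive_near_eq (R : realType) (f g : R -> R) (t df : R) :
  (\forall x \near t, f x = g x) -> is_derive t 1 f df -> is_derive t 1 g df.
Proof.
move=> fg [dfr dfv].
have [dg eg] : derivable g t 1 /\ 'D_1 f t = 'D_1 g t.
  split; last by apply: near_eq_derive => //; rewrite oner_neq0.
  by apply: near_eq_derivable dfr; rewrite ?oner_neq0.
by split => //; rewrite -eg.
Qed.

Lemma is_derive_oppx (R : realType) (G : R -> R) (t dG : R) :
  is_derive (- t) 1 G dG -> is_derive t 1 (fun x => G (- x)) (- dG).
Proof.
move=> dG'.
have := @is_derive1_comp R G (-%R) t _ _ dG' (is_deriveNid t 1).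
by rewrite mulrN1.
Qed.

(** Primitives based at -1 cover [t > -1] only. The left half line comes from reflecting [g]; on
    [(-1, 1)] both pieces have the same derivative and so agree up to a constant. *)
Lemma continuous_primitive (R : realType) (g : R -> R) :
  continuous g ->
  exists G : R -> R, G 0 = 0 /\ forall t : R, is_derive t 1 G (g t).
Proof.
move=> cg.
have [G1 dG1] := continuous_primitive_right _ _ cg.
have [|G2' dG2'] := continuous_primitive_right _ (fun x => g (- x)).
  move=> x; apply: continuous_comp; last exact: cg.
  exact: opp_continuous.
pose G2 x := - G2' (- x).
have dG2 (t : R) : t < 1 -> is_derive t 1 G2 (g t).
  move=> t1; have /is_derive_oppx : is_derive (- t) 1 G2' (g (- - t)).
    by apply: dG2'; rewrite ltrN2.
  by move=> /(is_deriveN); rewrite !opprK.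
have G12 (t : R) : -1 < t -> t < 1 -> G1 t - G1 0 = G2 t - G2 0.
  move=> t1 t2.
  pose D x := G1 x - G2 x.
  have dD (x : R) : -1 < x -> x < 1 -> is_derive x 1 D 0.
    move=> x1 x2; have := is_deriveB (dG1 _ x1) (dG2 _ x2).
    by rewrite subrr.
  suff : D t = D 0 by rewrite /D; lra.
  have cD (x : R) : -1 < x -> x < 1 -> {for x, continuous D}.
    move=> x1 x2; apply: differentiable_continuous.
    apply/derivable1_diffP; exact: (@ex_derive _ _ _ _ _ _ _ (dD x x1 x2)).
  case: (ltgtP t 0) => [t0|t0|-> //].
    have [x|x|c /itvP cc] := @MVT _ D (fun=> 0) t 0 t0; last by lra.
      by rewrite in_itv/= => /andP[? ?]; apply: dD; lra.
    apply: continuous_in_subspaceT => y.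
    by rewrite inE/= in_itv/= => /andP[? ?]; apply: cD; lra.
  have [x|x|c /itvP cc] := @MVT _ D (fun=> 0) 0 t t0; last by lra.
    by rewrite in_itv/= => /andP[? ?]; apply: dD; lra.
  apply: continuous_in_subspaceT => y.
  by rewrite inE/= in_itv/= => /andP[? ?]; apply: cD; lra.
pose G x := if x < 0 then G2 x - G2 0 else G1 x - G1 0.
exists G; split; first by rewrite /G ltxx subrr.
move=> t; have [t1|t1] := ltP t 1.
  apply: (@is_derive_near_eq _ (fun x => G2 x - G2 0)).
    near=> x; rewrite /G; case: ltP => // x0; rewrite G12//.
      by apply: lt_le_trans x0; lra.
    by near: x; exact: lt_nbhsl.
  have := is_deriveB (dG2 _ t1) (is_derive_cst (G2 0) t 1).
  by rewrite subr0.
apply: (@is_derive_near_eq _ (fun x => G1 x - G1 0)).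
  near=> x; rewrite /G; case: ltP => // x0; suff : 0 < x by lra.
  by near: x; apply: lt_nbhsr; lra.
have t1' : -1 < t by lra.
have := is_deriveB (dG1 _ t1') (is_derive_cst (G1 0) t 1).
by rewrite subr0.
Unshelve. all: by end_near. Qed.

(** Total in [g], so that recursive definitions through [duhamel] can precede the proofs of
    continuity. *)
Definition primitive (R : realType) (g : R -> R) : R -> R :=
  xget (fun=> 0) [set G | G 0 = 0 /\ forall t : R, is_derive t 1 G (g t)].

Lemma primitiveP (R : realType) (g : R -> R) : continuous g ->
  primitive R g 0 = 0 /\ forall t : R, is_derive t 1 (primitive R g) (g t).
Proof.
move=> /continuous_primitive[G hG].
exact: (@xgetPex _ (fun=> 0) [set G : R -> R | _] (ex_intro _ G hG)).
Qed.

(** Variation of constants: for continuous [g], the solution of [y' = c y + g] with [y 0 = y0]. *)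
Definition duhamel (R : realType) (c y0 : R) (g : R -> R) (t : R) : R :=
  expR (c * t) * (y0 + primitive R (fun s => expR (- (c * s)) * g s) t).

Lemma is_derive_expRM (R : realType) (c t : R) :
  is_derive t 1 (fun s : R => expR (c * s)) (c * expR (c * t)).
Proof.
have dc : is_derive t (1 : R) (fun s : R => c * s) c.
  have := is_deriveZ c (is_derive_id t (1 : R)).
  by rewrite /GRing.scale /= mulr1.
have := @is_derive1_comp R (@expR R) (fun s => c * s) t _ _
  (is_derive_expR (c * t)) dc.
by rewrite mulrC.
Qed.

Lemma is_derive_continuous (R : realType) (f : R -> R) (df : R -> R) :
  (forall t : R, is_derive t 1 f (df t)) -> continuous f.
Proof.
move=> hf t; apply: differentiable_continuous; apply/derivable1_diffP.
exact: (@ex_derive _ _ _ _ _ _ _ (hf t)).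
Qed.

Lemma is_deriveMR (R : realType) (f g : R -> R) (t df dg : R) :
  is_derive t 1 f df -> is_derive t 1 g dg ->
  is_derive t 1 (fun x => f x * g x) (df * g t + f t * dg).
Proof.
move=> hf hg; have := is_deriveM hf hg.
by rewrite /GRing.scale/= addrC [g t * _]mulrC.
Qed.

Section Duhamel.
Variables (R : realType) (c y0 : R) (g : R -> R).
Hypothesis cg : continuous g.

Let weighted_continuous : continuous (fun s => expR (- (c * s)) * g s).
Proof.
move=> t; apply: cvgM; last exact: cg.
have := is_derive_continuous _ _ _ (is_derive_expRM _ (- c)).
by under eq_fun do rewrite mulNr; apply.
Qed.

Lemma duhamel0 : duhamel R c y0 g 0 = y0.
Proof.
by rewrite /duhamel (primitiveP _ _ weighted_continuous).1 mulr0 expR0 mul1r addr0.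
Qed.

Lemma is_derive_duhamel (t : R) :
  is_derive t 1 (duhamel R c y0 g) (c * duhamel R c y0 g t + g t).
Proof.
have := is_deriveMR _ _ _ _ _ _ (is_derive_expRM _ c t)
  (is_deriveD (is_derive_cst y0 t (1 : R))
    ((primitiveP _ _ weighted_continuous).2 t)).
congr (is_derive _ _ _ _).
by rewrite add0r /= mulrA -expRD subrr expR0 mul1r /duhamel mulrA.
Qed.

Lemma duhamel_continuous : continuous (duhamel R c y0 g).
Proof. exact: is_derive_continuous is_derive_duhamel. Qed.

End Duhamel.

(** Comparison principle: [expR (q * x) * D x] is nondecreasing on [[0, t]]. With [D] the difference
    of two sides, it drives the inductions on the number of jumps. *)
Lemma linear_ode_ge0 (R : realType) (q : R) (D D' : R -> R) (t : R) :
  0 <= t ->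
  (forall s : R, is_derive s 1 D (D' s)) ->
  (forall s, 0 <= s -> s <= t -> 0 <= D' s + q * D s) -> 0 <= D 0 -> 0 <= D t.
Proof.
move=> t0 dD hD D0.
pose E x := expR (q * x) * D x.
have dE (x : R) : is_derive x 1 E (expR (q * x) * (D' x + q * D x)).
  have := is_deriveMR _ _ _ _ _ _ (is_derive_expRM _ q x) (dD x).
  congr (is_derive _ _ _ _); ring.
suff : E 0 <= E t.
  by rewrite /E mulr0 expR0 mul1r => /(le_trans D0); rewrite pmulr_rge0 ?expR_gt0.
apply: (@ger0_derive1_ndecr R E 0 t) => [x _|x||//|//|//].
- exact: (@ex_derive _ _ _ _ _ _ _ (dE x)).
- rewrite in_itv/= => /andP[/ltW x0 /ltW xt].
  rewrite derive1E (@derive_val _ _ _ _ _ _ _ (dE x)).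
  by rewrite mulr_ge0 ?expR_ge0// hD.
- exact/continuous_subspaceT/(is_derive_continuous _ _ _ dE).
Qed.

(** The integrand is the derivative in [u] of [- (expR (- q * u) * y (t - u))]. This turns the
    integral over the first jump time into a linear equation. *)
Lemma convolution_linear_ode (R : realType) (q : R) (y G : R -> R) (t : R) :
  0 <= t -> continuous G ->
  (forall s : R, is_derive s 1 y (- q * y s + G s)) ->
  (\int[lebesgue_measure]_(u in `[0%R, t]) (expR (- q * u) * G (t - u))%:E =
   (y t - expR (- q * t) * y 0)%:E)%E.
Proof.
move=> t0 cG dy; move: t0; rewrite le_eqVlt => /predU1P[<-|t0].
  by rewrite set_itv1 integral_set1 mulr0 expR0 mul1r subrr.
pose Fn u := - (expR (- q * u) * y (t - u)).
have dF (u : R) : is_derive u 1 Fn (expR (- q * u) * G (t - u)).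
  have dB : is_derive u (1 : R) (fun x : R => t - x) (- 1).
    by have := is_deriveB (is_derive_cst t u (1 : R)) (is_derive_id u 1); rewrite sub0r.
  have dyt := @is_derive1_comp R y (fun x => t - x) u _ _ (dy (t - u)) dB.
  have := is_deriveN (is_deriveMR _ _ _ _ _ _ (is_derive_expRM _ (- q) u) dyt).
  congr (is_derive _ _ _ _); rewrite /=; ring.
have cF := is_derive_continuous _ _ _ dF.
rewrite (@continuous_FTC2 _ _ Fn) //.
- by rewrite -EFinB /Fn subrr subr0 mulr0 expR0; congr (_%:E); ring.
- apply: continuous_subspaceT => u; apply: cvgM.
    exact: (is_derive_continuous _ _ _ (is_derive_expRM _ (- q))).
  apply: continuous_comp; last exact: cG.
  by apply: cvgB; [exact: cvg_cst|exact: cvg_id].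
- split=> [u _||].
  + exact: (@ex_derive _ _ _ _ _ _ _ (dF u)).
  + exact/cvg_at_right_filter/cF.
  + exact/cvg_at_left_filter/cF.
- by move=> u _; rewrite derive1E (@derive_val _ _ _ _ _ _ _ (dF u)).
Qed.

(** * The branching random walk in a box *)

Section Transition.
Variables (R : realType) (d : nat) (kappa : R) (n : nat) (w : field R d).
Implicit Types (s : config d) (k : nat) (t : R).

Local Notation Q := (exit_rate kappa n w).
Local Notation J := (jumps kappa n w).

(* Index shift: [trans_prob s' k.+1 s] is [transition_upto k], see
   [transition_uptoE]; starting from 0 makes every induction on k trivial at 0. *)
Fixpoint trans_prob (s' : config d) k s : R -> R :=
  if k is k'.+1 then
    duhamel R (- Q s) (s == s')%:R
      (fun t => \sum_(e <- J s) e.1 * trans_prob s' k' e.2 t)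
  else fun=> 0.

Lemma continuous_sum (I : Type) (r : seq I) (f : I -> R -> R) :
  (forall i, continuous (f i)) -> continuous (fun t => \sum_(i <- r) f i t).
Proof.
move=> cf; elim: r => [|i r IH].
  by under eq_fun do rewrite big_nil; move=> t; exact: cvg_cst.
by under eq_fun do rewrite big_cons; move=> t; apply: cvgD; [exact: cf|exact: IH].
Qed.

Lemma continuous_scale (a : R) (f : R -> R) :
  continuous f -> continuous (fun t => a * f t).
Proof. by move=> cf t; apply: cvgM; [exact: cvg_cst|exact: cf]. Qed.

Lemma trans_prob_continuous s' k s : continuous (trans_prob s' k s).
Proof.
elim: k s => [|k IH] s /=; first by move=> t; exact: cvg_cst.
apply: duhamel_continuous.
by apply: continuous_sum => e; apply: continuous_scale; exact: IH.
Qed.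

Lemma trans_probS_ode s' k s t :
  is_derive t 1 (trans_prob s' k.+1 s)
    (- Q s * trans_prob s' k.+1 s t + \sum_(e <- J s) e.1 * trans_prob s' k e.2 t).
Proof.
apply: is_derive_duhamel.
apply: continuous_sum => e; apply: continuous_scale; exact: trans_prob_continuous.
Qed.

Lemma trans_prob0 s' k s : trans_prob s' k.+1 s 0 = (s == s')%:R.
Proof.
apply: duhamel0.
apply: continuous_sum => e; apply: continuous_scale; exact: trans_prob_continuous.
Qed.

Lemma transition_uptoE s' k s t : 0 <= t ->
  transition_upto kappa n w k t s s' = (trans_prob s' k.+1 s t)%:E.
Proof.
elim: k s t => [|k IH] s t t0.
  (* No jump allowed: with zero source, the convolution identity forces [trans_prob] to be a pure
     exponential. *)
  rewrite [LHS]/= adde0; congr (_%:E).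
  have c0 : continuous ((fun=> 0) : R -> R) by move=> x; exact: cvg_cst.
  have ode (x : R) : is_derive x 1 (trans_prob s' 1 s)
      (- Q s * trans_prob s' 1 s x + 0).
    have := trans_probS_ode s' 0 s x.
    by congr (is_derive _ _ _ _); rewrite big1 // => e _; rewrite mulr0.
  have := convolution_linear_ode _ _ _ _ _ t0 c0 ode.
  under eq_integral do rewrite mulr0.
  rewrite integral0 trans_prob0 => -[h].
  by apply/esym/subr0_eq/esym.
rewrite [LHS]/=.
pose G t := \sum_(e <- J s) e.1 * trans_prob s' k.+1 e.2 t.
have cG : continuous G.
  by apply: continuous_sum => e; apply: continuous_scale; exact: trans_prob_continuous.
have -> : (\int[lebesgue_measure]_(u in `[0%R, t])
       ((expR (- exit_rate kappa n w s * u))%:E *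
        \sum_(e <- J s) e.1%:E * transition_upto kappa n w k (t - u) e.2 s') =
   \int[lebesgue_measure]_(u in `[0%R, t]) (expR (- Q s * u) * G (t - u))%:E)%E.
  apply: eq_integral => u; rewrite inE/= in_itv/= => /andP[u0 ut].
  rewrite EFinM; congr (_ * _)%E.
  rewrite /G -sumEFin; apply: eq_bigr => e _.
  by rewrite IH ?subr_ge0.
rewrite (convolution_linear_ode _ _ _ _ _ t0 cG (trans_probS_ode s' k.+1 s)).
by rewrite trans_prob0 -EFinD; congr (_%:E); ring.
Qed.

Lemma big_jumps s (f : R * config d -> R) :
  \sum_(e <- J s) f e =
  \sum_(i < size s) \sum_(e <- particle_events kappa n w (nth 0 s i))
     f (e.1, take i s ++ e.2 ++ drop i.+1 s).
Proof.
rewrite /jumps big_allpairs_dep/= -[in LHS](subn0 (size s)) -/(index_iota 0 (size s)).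
by rewrite big_mkord.
Qed.

End Transition.

Lemma size_neighbours (d : nat) (x : Zd d) : size (neighbours x) = (2 * d)%N.
Proof. by rewrite size_cat !size_map -enumT size_enum_ord mul2n addnn. Qed.

(** * Reduction of the first moment to linear equations indexed by sites *)

Section ManyToOne.
Variables (R : realType) (d : nat) (kappa : R) (n : nat) (w : field R d).
Hypotheses (kappa0 : 0 <= kappa) (hw : field_range w).
Implicit Types (s : config d) (k : nat) (t : R) (x y : Zd d).

Local Notation Q := (exit_rate kappa n w).
Local Notation J := (jumps kappa n w).

(** Diagonal coefficient of the moment equations: births minus deaths minus departures. Where [v_-]
    is infinite [fine] returns 0, but such sites are filtered out of the neighbour sums. *)
Definition growth x : R :=
  (w x).2 - fine (w x).1 - (2 * d)%:R * kappa.

Definition sum_over (f : Zd d -> R) s : R := \sum_(x <- s) f x.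

Lemma sum_particle_events x (f : R * config d -> R) :
  \sum_(e <- particle_events kappa n w x) f e =
  f ((w x).2, [:: x; x]) + f (fine (w x).1, [::]) +
  \sum_(y <- neighbours x) f (kappa, [seq z <- [:: y] | alive n w z]).
Proof. by rewrite !big_cons big_map addrA. Qed.

Lemma exit_rateE s :
  Q s = \sum_(x <- s) ((w x).2 + fine (w x).1 + (2 * d)%:R * kappa).
Proof.
rewrite /exit_rate big_jumps [RHS](big_nth 0) big_mkord; apply: eq_bigr => i _.
rewrite sum_particle_events/= big_const_seq count_predT size_neighbours.
by rewrite iter_addr_0 mulr_natl.
Qed.

(** An event changes only its own particle's term of an additive functional, so the generator sends
    such functionals to additive ones. This closes the first-moment equations on sites. *)
Lemma generator_sum_over s (f : Zd d -> R) :
  \sum_(e <- J s) e.1 * sum_over f e.2 =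
  Q s * sum_over f s +
  \sum_(x <- s) (growth x * f x +
    kappa * \sum_(y <- neighbours x | alive n w y) f y).
Proof.
rewrite exit_rateE [in RHS]big_distrl/= -big_split/= [RHS](big_nth 0) big_mkord.
rewrite big_jumps; apply: eq_bigr => i _; set x := nth 0 s i.
have sE : sum_over f s = sum_over f (take i s) + f x + sum_over f (drop i.+1 s).
  rewrite -[in LHS](cat_take_drop i s) /sum_over big_cat/= -addrA; congr (_ + _).
  by rewrite (drop_nth 0)// big_cons.
have addE u : sum_over f (take i s ++ u ++ drop i.+1 s) =
    sum_over f s - f x + sum_over f u.
  by rewrite sE /sum_over !big_cat/=; ring.
under [LHS]eq_bigr => e _ do rewrite addE mulrDr ![(_, _).1]/=.
rewrite sum_particle_events/=.
rewrite big_split/= big_const_seq count_predT size_neighbours iter_addr_0.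
rewrite -mulr_natl.
have -> : \sum_(y <- neighbours x)
    kappa * sum_over f (if alive n w y then [:: y] else [::]) =
    kappa * \sum_(y <- neighbours x | alive n w y) f y.
  rewrite big_distrr/= [RHS]big_mkcond/=; apply: eq_bigr => y _.
  by case: ifP => _; rewrite /sum_over ?big_nil ?mulr0// big_seq1.
by rewrite /growth /sum_over !big_cons !big_nil; ring.
Qed.

(* Expected number of descendants at time t of one particle at x, counting only
   those whose ancestral line made fewer than k moves. *)
Fixpoint box_moment k x : R -> R :=
  if k is k'.+1 then
    duhamel R (growth x) 1
      (fun t => kappa * \sum_(y <- [seq y <- neighbours x | alive n w y])
                          box_moment k' y t)
  else fun=> 0.

Lemma box_moment_continuous k x : continuous (box_moment k x).
Proof.
elim: k x => [|k IH] x /=; first by move=> t; exact: cvg_cst.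
by apply: duhamel_continuous; apply: continuous_scale; exact: continuous_sum.
Qed.

Lemma box_momentS_ode k x t :
  is_derive t 1 (box_moment k.+1 x) (growth x * box_moment k.+1 x t +
    kappa * \sum_(y <- neighbours x | alive n w y) box_moment k y t).
Proof.
rewrite -big_filter; apply: is_derive_duhamel.
by apply: continuous_scale; apply: continuous_sum => y; exact: box_moment_continuous.
Qed.

Lemma box_moment0 k x : box_moment k.+1 x 0 = 1.
Proof.
apply: duhamel0.
by apply: continuous_scale; apply: continuous_sum => y; exact: box_moment_continuous.
Qed.

Lemma box_moment_ge0 k x t : 0 <= t -> 0 <= box_moment k x t.
Proof.
elim: k x t => [//|k IH] x t t0.
apply: (linear_ode_ge0 _ (- growth x) _ _ _ t0 (box_momentS_ode k x)).
  move=> r r0 _; rewrite mulNr addrAC subrr add0r mulr_ge0// sumr_ge0// => y _.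
  exact: IH.
by rewrite box_moment0.
Qed.

Lemma box_moment_mono k x t : 0 <= t -> box_moment k x t <= box_moment k.+1 x t.
Proof.
elim: k x t => [|k IH] x t t0; first exact: box_moment_ge0.
rewrite -subr_ge0.
apply: (linear_ode_ge0 _ (- growth x) (fun t => box_moment k.+2 x t - box_moment k.+1 x t)
  _ _ t0 (fun r => is_deriveB (box_momentS_ode k.+1 x r) (box_momentS_ode k x r))).
  move=> r r0 _.
  rewrite [leRHS](_ : _ = kappa * \sum_(y <- neighbours x | alive n w y)
    (box_moment k.+1 y r - box_moment k y r)); last by rewrite sumrB; ring.
  by rewrite mulr_ge0// sumr_ge0// => y _; rewrite subr_ge0 IH.
by rewrite !box_moment0 subrr.
Qed.

(** A finite list of final states allows differentiation term by term; the full expectation is a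
    supremum over such lists. *)
Definition partial_moment (A : seq (config d)) k s t : R :=
  \sum_(s' <- A) (size s')%:R * trans_prob R d kappa n w s' k s t.

Lemma is_derive_sumr (I : Type) (r : seq I) (f : I -> R -> R) (df : I -> R) t :
  (forall i, is_derive t 1 (f i) (df i)) ->
  is_derive t 1 (fun t => \sum_(i <- r) f i t) (\sum_(i <- r) df i).
Proof.
move=> hf; elim: r => [|i r IH].
  rewrite big_nil; under eq_fun do rewrite big_nil; exact: is_derive_cst.
rewrite big_cons; under eq_fun do rewrite big_cons.
exact: is_deriveD (hf i) IH.
Qed.

Lemma is_derive_scaler (a : R) (f : R -> R) t df :
  is_derive t 1 f df -> is_derive t 1 (fun t => a * f t) (a * df).
Proof. by move=> hf; have := is_deriveZ a hf. Qed.

Lemma partial_momentS_ode A k s t :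
  is_derive t 1 (partial_moment A k.+1 s)
    (- Q s * partial_moment A k.+1 s t +
     \sum_(e <- J s) e.1 * partial_moment A k e.2 t).
Proof.
have := is_derive_sumr _ A _ _ t
  (fun s' => is_derive_scaler (size s')%:R _ t _ (trans_probS_ode R d kappa n w s' k s t)).
congr (is_derive _ _ _ _); under eq_bigr do rewrite mulrDr; rewrite big_split/=.
rewrite /partial_moment big_distrr/=; congr (_ + _).
  by apply: eq_bigr => s' _; rewrite mulrCA.
under [RHS]eq_bigr do rewrite big_distrr/=.
rewrite exchange_big/=; apply: eq_bigr => s' _.
by rewrite big_distrr/=; apply: eq_bigr => e _; rewrite mulrCA.
Qed.

Lemma partial_moment0 A k s : uniq A -> partial_moment A k.+1 s 0 <= (size s)%:R.
Proof.
move=> uA; rewrite /partial_moment.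
under eq_bigr do rewrite trans_prob0.
have [sA|sA] := boolP (s \in A).
  rewrite (bigD1_seq s)//= eqxx mulr1 big1 ?addr0// => s' /negPf.
  by rewrite eq_sym => ->; rewrite mulr0.
rewrite big_seq big1 // => s' s'A.
by case: eqP => [ss'|_]; [rewrite ss' s'A in sA|rewrite mulr0].
Qed.

(** The rate of [x] is one summand of [Q s]; its deaths and departures cancel those in
    [growth x]. *)
Lemma exit_rate_ge s x : x \in s -> 0 <= Q s + growth x.
Proof.
move=> xs; have rate0 y : 0 <= (w y).2 + fine (w y).1 + (2 * d)%:R * kappa.
  have [w1 w2] := hw y.
  by rewrite !addr_ge0// ?fine_ge0// mulr_ge0.
have -> : Q s = (w x).2 + fine (w x).1 + (2 * d)%:R * kappa +
    \sum_(y <- rem x s) ((w y).2 + fine (w y).1 + (2 * d)%:R * kappa).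
  by rewrite exit_rateE (perm_big _ (perm_to_rem xs)) big_cons.
rewrite /growth; have [_ w2] := hw x.
rewrite (_ : _ + _ = (w x).2 *+ 2 +
   \sum_(y <- rem x s) ((w y).2 + fine (w y).1 + (2 * d)%:R * kappa)); last by ring.
by rewrite addr_ge0 ?sumr_ge0// mulrn_wge0.
Qed.

Lemma jump_rate_ge0 s (e : R * config d) : e \in J s -> 0 <= e.1.
Proof.
move=> /allpairsPdep[i [e' [_ e'in ->]]] /=.
have [w1 w2] := hw (nth 0 s i).
move: e'in; rewrite !inE => /or3P[/eqP ->//|/eqP -> /=|/mapP[y _ ->]//].
exact: fine_ge0.
Qed.

(** An ancestral line moves at most as often as the whole system jumps, and dropping final states
    outside [A] only lowers the sum. *)
Lemma partial_moment_le A k s t : uniq A -> 0 <= t ->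
  partial_moment A k s t <= sum_over (fun x => box_moment k x t) s.
Proof.
move=> uA; elim: k s t => [|k IH] s t t0.
  by rewrite /partial_moment /sum_over !big1//= => i _; rewrite mulr0.
have dV (r : R) := is_derive_sumr _ s _ _ r (fun x => box_momentS_ode k x r).
rewrite -subr_ge0.
apply: (linear_ode_ge0 _ (Q s)
  (fun t => sum_over (fun x => box_moment k.+1 x t) s - partial_moment A k.+1 s t)
  _ _ t0 (fun r => is_deriveB (dV r) (partial_momentS_ode A k s r))).
  move=> r r0 _.
  rewrite [leRHS](_ : _ = Q s * sum_over (fun x => box_moment k.+1 x r) s +
    \sum_(x <- s) (growth x * box_moment k.+1 x r +
      kappa * \sum_(y <- neighbours x | alive n w y) box_moment k y r) -
    \sum_(e <- J s) e.1 * partial_moment A k e.2 r); last by ring.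
  rewrite subr_ge0.
  apply: (@le_trans _ _ (\sum_(e <- J s) e.1 * sum_over (fun x => box_moment k x r) e.2)).
    rewrite big_seq [leRHS]big_seq; apply: ler_sum => e eJ.
    apply: ler_wpM2l; last exact: IH.
    exact: (jump_rate_ge0 s).
  rewrite generator_sum_over big_distrr/= -!big_split/= big_distrr/= -big_split/=.
  rewrite big_seq [leRHS]big_seq; apply: ler_sum => x xs.
  (* The coefficient [Q s + growth x] is nonnegative, which permits raising [box_moment] from level
     [k] to [k.+1]. *)
  rewrite !addrA lerD2r// -!mulrDl ler_wpM2l//; first exact: exit_rate_ge.
  exact: box_moment_mono.
rewrite subr_ge0 (le_trans (partial_moment0 _ _ _ uA))//.
rewrite /sum_over; under eq_bigr do rewrite box_moment0.
by rewrite big_const_seq count_predT iter_addr_0.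
Qed.

Lemma trans_prob_ge0 s' k s t : 0 <= t -> 0 <= trans_prob R d kappa n w s' k s t.
Proof.
elim: k s t => [//|k IH] s t t0.
apply: (linear_ode_ge0 _ (Q s) _ _ _ t0 (trans_probS_ode R d kappa n w s' k s)).
  move=> r r0 _; rewrite mulNr addrAC addNr add0r big_seq sumr_ge0// => e eJ.
  by rewrite mulr_ge0 ?IH// (jump_rate_ge0 s).
by rewrite trans_prob0.
Qed.

Lemma trans_prob_mono s' k s t : 0 <= t ->
  trans_prob R d kappa n w s' k s t <= trans_prob R d kappa n w s' k.+1 s t.
Proof.
elim: k s t => [|k IH] s t t0; first exact: trans_prob_ge0.
rewrite -subr_ge0.
apply: (linear_ode_ge0 _ (Q s) (fun t => trans_prob R d kappa n w s' k.+2 s t -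
    trans_prob R d kappa n w s' k.+1 s t) _ _ t0
  (fun r => is_deriveB (trans_probS_ode R d kappa n w s' k.+1 s r)
    (trans_probS_ode R d kappa n w s' k s r))).
  move=> r r0 _.
  rewrite [leRHS](_ : _ = \sum_(e <- J s) (e.1 *
    trans_prob R d kappa n w s' k.+1 e.2 r - e.1 *
    trans_prob R d kappa n w s' k e.2 r)); last by rewrite sumrB; ring.
  rewrite big_seq sumr_ge0// => e eJ.
  by rewrite -mulrBr mulr_ge0 ?subr_ge0 ?IH// (jump_rate_ge0 s).
by rewrite !trans_prob0 subrr.
Qed.

Lemma transition_uptoS_le (k k' : nat) s s' t : 0 <= t -> (k <= k')%N ->
  (transition_upto kappa n w k t s s' <= transition_upto kappa n w k' t s s')%E.
Proof.
move=> t0 kk'; rewrite !transition_uptoE// lee_fin.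
rewrite -(subnK kk'); elim: (k' - k)%N => [//|m IH]; apply: le_trans IH _; exact: trans_prob_mono.
Qed.

(** On each finite set of final states monotone convergence removes the bound on the number of
    jumps; the supremum over finite sets follows. *)
Lemma expected_size_le s t (B : R) : 0 <= t ->
  (forall k, sum_over (fun x => box_moment k x t) s <= B) ->
  (\esum_(s' in [set: config d])
    ((size s')%:R%:E * transition kappa n w t s s') <= B%:E)%E.
Proof.
move=> t0 hB; apply: ge_ereal_sup => _ [A [finA _] <-].
rewrite fsbig_finite//=; set X := enum_fset _.
have uX : uniq X by exact: fset_uniq.
have cvg_term s' : ((size s')%:R%:E * transition_upto kappa n w k t s s')%E
    @[k --> \oo] --> ((size s')%:R%:E * transition kappa n w t s s')%E.
  apply: cvgeZl => //.
  apply: ereal_nondecreasing_cvgn => i j ij.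
  exact: transition_uptoS_le.
have cvg_sum : (\sum_(s' <- X) ((size s')%:R%:E * transition_upto kappa n w k t s s'))%E
    @[k --> \oo] --> (\sum_(s' <- X) ((size s')%:R%:E * transition kappa n w t s s'))%E.
  apply: cvg_nnesum => [s' _|s' _].
    near=> k; rewrite mule_ge0 ?lee_fin// transition_uptoE// lee_fin.
    exact: trans_prob_ge0.
  exact: cvg_term.
rewrite -(cvg_lim _ cvg_sum)//; apply: lime_le.
  by apply/cvg_ex; eexists; exact: cvg_sum.
near=> k; under eq_bigr do rewrite transition_uptoE// -EFinM.
rewrite sumEFin lee_fin; apply: le_trans (hB k.+1).
exact: partial_moment_le.
Unshelve. all: by end_near. Qed.

Lemma expected_size_ge s t A k : 0 <= t -> uniq A ->
  ((partial_moment A k.+1 s t)%:E <= \esum_(s' in [set: config d])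
    ((size s')%:R%:E * transition kappa n w t s s'))%E.
Proof.
move=> t0 uA; apply: (@le_trans _ _
  (\sum_(s' <- A) ((size s')%:R%:E * transition kappa n w t s s'))%E).
  rewrite /partial_moment -sumEFin; apply: lee_sum => s' _.
  rewrite EFinM -transition_uptoE//; apply: lee_wpmul2l; first by rewrite lee_fin.
  by apply: ereal_sup_ubound; exists k.
apply: ereal_sup_ubound; exists [set` A]; first by split; [exact: finite_seq|].
by rewrite -fsbig_seq.
Qed.

End ManyToOne.

(** * Upper bound for the quenched first moment *)

Section Jensen.
Variables (R : realType) (d : nat) (kappa : R).
Hypothesis kappa0 : 0 <= kappa.
Implicit Types (x y : Zd d) (t : R).

Local Notation rate := ((2 * d)%:R * kappa).

Definition nbr_sum (f : Zd d -> R) x : R := \sum_(y <- neighbours x) f y.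

Lemma sum_neighbours_cst (a : R) x :
  \sum_(y <- neighbours x) a = (2 * d)%:R * a.
Proof. by rewrite big_const_seq count_predT size_neighbours iter_addr_0 mulr_natl. Qed.

(* Equals [kappa ^+ i] times the integral of [exp(- rate * s) s ^+ i / i!] over
   s in [0, t]: the expected time within [0, t] during which the trajectory of
   the walk so far is one given i-step path. *)
Fixpoint path_time i : R -> R :=
  if i is i'.+1 then duhamel R (- rate) 0 (fun t => kappa * path_time i' t)
  else duhamel R (- rate) 0 (fun=> 1).

Lemma continuous_cst (a : R) : continuous ((fun=> a) : R -> R).
Proof. by move=> t; exact: cvg_cst. Qed.

Lemma path_time_continuous i : continuous (path_time i).
Proof.
elim: i => [|i IH]; apply: duhamel_continuous; first exact: continuous_cst.
exact: continuous_scale.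
Qed.

Lemma path_time0_ode t : is_derive t 1 (path_time 0) (- rate * path_time 0 t + 1).
Proof. exact: is_derive_duhamel (continuous_cst 1) t. Qed.

Lemma path_timeS_ode i t :
  is_derive t 1 (path_time i.+1) (- rate * path_time i.+1 t + kappa * path_time i t).
Proof. by apply: is_derive_duhamel; apply: continuous_scale; exact: path_time_continuous. Qed.

Lemma path_time_at0 i : path_time i 0 = 0.
Proof.
case: i => [|i]; apply: duhamel0; first exact: continuous_cst.
by apply: continuous_scale; exact: path_time_continuous.
Qed.

Lemma path_time_ge0 i t : 0 <= t -> 0 <= path_time i t.
Proof.
elim: i t => [|i IH] t t0.
  apply: (linear_ode_ge0 _ rate _ _ _ t0 path_time0_ode); last by rewrite path_time_at0.
  by move=> r r0 _; rewrite mulNr addrAC addNr add0r.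
apply: (linear_ode_ge0 _ rate _ _ _ t0 (path_timeS_ode i)); last by rewrite path_time_at0.
by move=> r r0 _; rewrite mulNr addrAC addNr add0r mulr_ge0 ?IH.
Qed.

(** As [iter i nbr_sum f x] sums [f] over the endpoints of the [i]-step paths from [x], this is the
    expected integral of [f] along the walk over [[0, t]], stopped at its [j]-th jump. *)
Definition occupation (f : Zd d -> R) j x t : R :=
  \sum_(i < j) path_time i t * iter i nbr_sum f x.

Lemma occupation0 f j x : occupation f j x 0 = 0.
Proof. by apply: big1 => i _; rewrite path_time_at0 mul0r. Qed.

Lemma iter_nbr_sum_ge0 f i x : (forall y, 0 <= f y) -> 0 <= iter i nbr_sum f x.
Proof. by move=> f0; elim: i x => [//|i IH] x; rewrite iterS sumr_ge0. Qed.

Lemma occupation_ge0 f j x t : (forall y, 0 <= f y) -> 0 <= t ->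
  0 <= occupation f j x t.
Proof.
by move=> f0 t0; apply: sumr_ge0 => i _; rewrite mulr_ge0 ?path_time_ge0 ?iter_nbr_sum_ge0.
Qed.

Lemma occupationS_ode f j x t :
  is_derive t 1 (occupation f j.+1 x)
    (- rate * occupation f j.+1 x t + f x +
     kappa * \sum_(y <- neighbours x) occupation f j y t).
Proof.
pose db i := - rate * path_time i t +
  (if i is i'.+1 then kappa * path_time i' t else 1).
have dpt i : is_derive t 1 (path_time i) (db i).
  by case: i => [|i]; [exact: path_time0_ode|exact: path_timeS_ode].
have := is_derive_sumr _ _ (index_enum 'I_j.+1)
  (fun (i : 'I_j.+1) t => iter i nbr_sum f x * path_time i t) _ t
  (fun i => is_derive_scaler _ (iter i nbr_sum f x) _ _ _ (dpt i)).
under eq_fun do under eq_bigr do rewrite mulrC.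
congr (is_derive _ _ _ _).
rewrite /db; under eq_bigr do rewrite mulrDr.
rewrite big_split/= -addrA; congr (_ + _).
  by rewrite /occupation big_distrr/=; apply: eq_bigr => i _; ring.
rewrite big_ord_recl/= mulr1; congr (_ + _).
rewrite /occupation exchange_big/= big_distrr/=; apply: eq_bigr => i _.
rewrite -big_distrr/= -/(nbr_sum (iter i nbr_sum f) x); ring.
Qed.

(** This is the total time spent on paths within [[0, t]]. In the equations [t] itself is a
    supersolution, as each site has [2 * d] neighbours. *)
Lemma occupation_cst1_le j x t : 0 <= t -> occupation (fun=> 1) j x t <= t.
Proof.
elim: j x t => [|j IH] x t t0; first by rewrite /occupation big_ord0.
rewrite -subr_ge0.
apply: (linear_ode_ge0 _ rate (fun t => t - occupation (fun=> 1) j.+1 x t) _ _ t0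
  (fun r => is_deriveB (is_derive_id r (1 : R)) (occupationS_ode _ j x r))).
  move=> r r0 _.
  rewrite [leRHS](_ : _ = kappa * (\sum_(y <- neighbours x) r -
    \sum_(y <- neighbours x) occupation (fun=> 1) j y r)); last first.
    by rewrite sum_neighbours_cst; ring.
  rewrite mulr_ge0// subr_ge0; apply: ler_sum => y _; exact: IH.
by rewrite occupation0 subr0.
Qed.

(** The tangent to [expR] at the weighted mean [m] lies below it, and the linear terms cancel in the
    weighted sum. *)
Lemma expR_weighted_convex (a b p q : R) : 0 <= p -> 0 <= q -> 0 < p + q ->
  (p + q) * expR ((p * a + q * b) / (p + q)) <= p * expR a + q * expR b.
Proof.
move=> p0 q0 pq; set m := _ / _.
have tangent (x : R) : expR m * (1 + (x - m)) <= expR x.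
  rewrite -[in leRHS](subrK m x) expRD [leRHS]mulrC.
  by rewrite ler_wpM2l ?expR_ge0// expR_ge1Dx.
apply: le_trans (lerD (ler_wpM2l p0 (tangent a)) (ler_wpM2l q0 (tangent b))).
have mE : m * (p + q) = p * a + q * b by rewrite /m divfK// gt_eqF.
rewrite [leRHS](_ : _ = expR m * (p + q + (p * a + q * b - m * (p + q)))); last by ring.
by rewrite mE subrr addr0 mulrC.
Qed.

Section Fixed_environment.
Variables (n : nat) (w : field R d) (T : R).
Hypotheses (hw : field_range w) (T0 : 0 < T).

Definition site_mgf x : R := fine (expeR (potential w x * T%:E)%E).

Lemma site_mgf_ge0 x : 0 <= site_mgf x.
Proof. by rewrite fine_ge0// expeR_ge0. Qed.

Lemma site_mgfE x : ((w x).1 < +oo)%E ->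
  site_mgf x = expR (T * ((w x).2 - fine (w x).1)).
Proof.
move=> wx; have [w1 _] := hw x.
rewrite /site_mgf /potential -[in LHS](@fineK _ (w x).1) ?ge0_fin_numE//.
by rewrite -EFinB -EFinM/= mulrC.
Qed.

(* The left side carries the weight [exp((T - t) z)] of a path prefix of length
   T - t, so that the bound is stable under prepending a stay at a site. *)
Lemma box_moment_prefix_le j x t z : ((w x).1 < +oo)%E -> 0 <= t -> t <= T ->
  T * expR ((T - t) * z) * box_moment R d kappa n w j x t <=
  (T - t) * expR (T * z) + occupation site_mgf j x t.
Proof.
elim: j x t z => [|j IH] x t z wx t0 tT.
  by rewrite mulr0 /occupation big_ord0 addr0 mulr_ge0 ?subr_ge0 ?expR_ge0.
set v := (w x).2 - fine (w x).1.
(* Weight of the path so far when time [r] remains: the prefix, then a stay of length [t - r] at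
   [x]. *)
pose E r := expR ((T - t) * z + v * t) * expR (- v * r).
have EE r : E r = expR ((T - t) * z + v * (t - r)).
  by rewrite /E -expRD; congr expR; ring.
(* Slack when time [r] remains, the stay at [x] being charged through [site_mgf x]; [D t] is the
   slack of the claim. *)
pose D r := ((T - t) * expR (T * z) + t * site_mgf x) - site_mgf x * r +
  occupation site_mgf j.+1 x r - T * (E r * box_moment R d kappa n w j.+1 x r).
suff : 0 <= D t.
  by rewrite /D EE subrr mulr0 addr0; lra.
have dE (r : R) : is_derive r 1 E (- v * E r).
  have := is_derive_scaler _ (expR ((T - t) * z + v * t)) _ _ _ (is_derive_expRM _ (- v) r).
  by congr (is_derive _ _ _ _); rewrite /E; ring.
have d1 (r : R) := is_deriveB (is_derive_cst ((T - t) * expR (T * z) + t * site_mgf x) r (1 : R))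
    (is_derive_scaler _ (site_mgf x) _ _ _ (is_derive_id r (1 : R))).
have d2 (r : R) := is_deriveMR _ _ _ _ _ _ (dE r) (box_momentS_ode R d kappa n w j x r).
have dD (r : R) := is_deriveB (is_deriveD (d1 r) (occupationS_ode site_mgf j x r))
  (is_derive_scaler _ T _ _ _ (d2 r)).
(* Convexity for the prolonged prefix of length [T - r], whose mean potential averages [z] and
   [v]. *)
have convex_prefix r : 0 <= r -> r <= t -> r < T ->
    (T - r) * expR (T * (((T - t) * z + v * (t - r)) / (T - r))) <=
    (T - t) * expR (T * z) + (t - r) * site_mgf x.
  move=> r0 rt rT; rewrite site_mgfE// -/v.
  have := @expR_weighted_convex (T * z) (T * v) (T - t) (t - r).
  rewrite !subr_ge0 (_ : T - t + (t - r) = T - r); last by ring.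
  rewrite subr_gt0 => /(_ tT rt rT); apply: le_trans.
  rewrite le_eqVlt; apply/orP; left; apply/eqP; congr (_ * expR _); ring.
apply: (linear_ode_ge0 _ rate D _ _ t0 dD).
  move=> r r0 rt.
  set X := (T - t) * expR (T * z) + (t - r) * site_mgf x.
  rewrite [leRHS](_ : _ = kappa * (\sum_(y <- neighbours x) X +
      \sum_(y <- neighbours x) occupation site_mgf j y r -
      \sum_(y <- neighbours x | alive n w y)
         T * E r * box_moment R d kappa n w j y r)); last first.
    rewrite sum_neighbours_cst /D /X /growth -/v.
    by move: (box_moment R d kappa n w j.+1 x r) => u; rewrite -big_distrr/=; ring.
  rewrite [X in _ - X]big_mkcond -big_split/= -sumrB mulr_ge0//.
  (* A neighbour that is not alive contributes no moment, so positivity suffices there. *)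
  apply: sumr_ge0 => y _; rewrite subr_ge0; case: ifP => [/andP[_ wy]|_]; last first.
    rewrite addr_ge0 ?occupation_ge0// ?addr_ge0 ?mulr_ge0 ?subr_ge0 ?expR_ge0//;
      exact: site_mgf_ge0.
  have rT := le_trans rt tT.
  (* If [r = T] then [t = T]: the prefix is empty, has no mean, and the induction hypothesis is
     taken at 0. *)
  move: (rT); rewrite le_eqVlt => /predU1P[rTE|rT'].
    have tE : t = T by apply/eqP; rewrite eq_le tT -rTE.
    have := IH y r 0 wy r0 rT.
    rewrite EE /X tE rTE !subrr !mul0r !mulr0 !add0r expR0.
    by [].
  have := IH y r (((T - t) * z + v * (t - r)) / (T - r)) wy r0 rT.
  rewrite EE mulrC [X in expR X]mulrC divfK ?subr_eq0 ?gt_eqF// mulrC.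
  by move=> /le_trans; apply; rewrite lerD2r; exact: convex_prefix.
rewrite /D EE !occupation0 box_moment0 mulr0 subr0 addr0 mulr1 subr0 subr_ge0.
have := convex_prefix 0 (lexx _) t0 T0.
by rewrite !subr0 [T * (_ / _)]mulrC divfK ?gt_eqF.
Qed.

Lemma box_moment_le j x : ((w x).1 < +oo)%E ->
  box_moment R d kappa n w j x T <= occupation site_mgf j x T / T.
Proof.
move=> wx; rewrite ler_pdivlMr//.
have := box_moment_prefix_le j x T 0 wx (ltW T0) (lexx _).
by rewrite subrr !mul0r expR0 mulr1 add0r mulrC.
Qed.

End Fixed_environment.

Lemma first_moment_le (w : field R d) (T : R) x : field_range w -> 0 < T ->
  (first_moment kappa w x T <=
   ereal_sup (range (fun j => (occupation (site_mgf w T) j x T / T)%:E)))%E.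
Proof.
move=> hw T0; set B := ereal_sup _.
have hB j : ((occupation (site_mgf w T) j x T / T)%:E <= B)%E.
  by apply: ereal_sup_ubound; exists j.
have B0 : (0 <= B)%E.
  apply: le_trans (hB 0%N); rewrite lee_fin divr_ge0 ?(ltW T0)//.
  by rewrite occupation_ge0// ?(ltW T0)// => y; exact: site_mgf_ge0.
apply: ge_ereal_sup => _ [n _ <-].
move: B B0 hB => [B||] B0 hB //; last by rewrite leey.
rewrite /first_moment_box; apply: expected_size_le => //; first exact: ltW.
move=> k; rewrite /initial_config gt_eqF//=; case: ifP => [/andP[_ wx]|_].
  rewrite /sum_over big_seq1; apply: le_trans (box_moment_le _ _ _ hw T0 _ _ wx) _.
  by have := hB k; rewrite lee_fin.
by rewrite /sum_over big_nil -lee_fin.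
Qed.

End Jensen.

(** * Lower bound for the quenched first moment *)

Section SingleSite.
Variables (R : realType) (d : nat) (kappa : R) (w : field R d).
Hypotheses (kappa0 : 0 <= kappa) (hw : field_range w).

Local Notation J := (jumps kappa 0 w).
Local Notation birth := ((w 0).2).
Local Notation death := (fine (w 0).1 + (2 * d)%:R * kappa).
Local Notation at0 m := (nseq m (0 : Zd d)).

Lemma in_box0_origin : in_box 0 (0 : Zd d).
Proof. by apply/forallP => i; rewrite mxE normr0. Qed.

Lemma in_box0_neighbours (y : Zd d) : y \in neighbours (0 : Zd d) -> ~~ in_box 0 y.
Proof.
rewrite mem_cat => /orP[] /mapP[i _ ->]; apply/forallPn; exists i.
  by rewrite !mxE !eqxx add0r.
by rewrite !mxE !eqxx sub0r normrN.
Qed.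

(** In the box reduced to the origin every move removes the particle. The system is a linear birth
    and death process, departures counting as deaths. *)
Lemma jumps_at0 m (g : config d -> R) :
  \sum_(e <- J (at0 m)) e.1 * g e.2 =
  m%:R * (birth * g (at0 m.+1) + death * g (at0 m.-1)).
Proof.
rewrite big_jumps size_nseq.
under eq_bigr => i _.
  rewrite nth_nseq ltn_ord take_nseq ?(ltnW (ltn_ord i))// drop_nseq.
  have eS : at0 i ++ [:: 0, 0 & at0 (m - i.+1)] = at0 m.+1.
    rewrite -[[:: 0, 0 & _]]/(at0 (m - i.+1).+2) -nseqD; congr nseq.
    by have := ltn_ord i; lia.
  have eP : at0 i ++ at0 (m - i.+1) = at0 m.-1.
    by rewrite -nseqD; congr nseq; have := ltn_ord i; lia.
  rewrite sum_particle_events/= eS eP big_seq_cond.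
  under [X in _ + X]eq_bigr => y /andP[yn _].
    rewrite /alive (negPf (in_box0_neighbours _ yn))/= eP.
    over.
  rewrite -big_seq_cond sum_neighbours_cst.
  over.
rewrite sumr_const card_ord -[LHS]mulr_natl; ring.
Qed.

Lemma exit_rate_at0 m : exit_rate kappa 0 w (at0 m) = m%:R * (birth + death).
Proof.
by rewrite exit_rateE big_nseq iter_addr_0 -[LHS]mulr_natl addrA.
Qed.

Variable M : nat.
Hypothesis M0 : (0 < M)%N.

Definition at0_configs : seq (config d) := [seq at0 m | m <- iota 0 M].

Lemma at0_configs_uniq : uniq at0_configs.
Proof.
rewrite map_inj_uniq ?iota_uniq// => m m' /(congr1 size).
by rewrite !size_nseq.
Qed.

Local Notation W k m := (partial_moment R d kappa 0 w at0_configs k (at0 m)).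

(** The subtracted term covers [m >= M]: the initial state is then missing from [at0_configs], and
    the left side is nonpositive. *)
Lemma at0_moment0 k m : m%:R - m%:R ^+ 2 / M%:R <= W k.+1 m 0 :> R.
Proof.
rewrite /partial_moment; under eq_bigr do rewrite trans_prob0.
have [mM|Mm] := ltnP m M.
  rewrite (bigD1_seq (at0 m)) ?at0_configs_uniq//=; last first.
    by apply/mapP; exists m; rewrite ?mem_iota.
  rewrite size_nseq eqxx mulr1 big1 ?addr0; last first.
    by move=> s' /negPf; rewrite eq_sym => ->; rewrite mulr0.
  by rewrite lerBlDr lerDl divr_ge0// exprn_ge0.
apply: (@le_trans _ _ 0); last by apply: sumr_ge0 => s' _; rewrite mulr_ge0.
by rewrite subr_le0 ler_pdivlMr ?ltr0n// expr2 ler_wpM2l// ler_nat.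
Qed.

Definition escape_bound k m : R :=
  m%:R ^+ 2 / (k + m)%:R + m%:R ^+ 2 / M%:R.

(** Births make the squared population grow at rate at most [3 * birth], since
    [m * ((m + 1)^2 - m^2) <= 3 * m^2]. A death lowers the denominator from [k.+1 + m] to
    [k + m.-1], which the smaller numerator outweighs. *)
Lemma escape_bound_supersolution k m :
  m%:R * (birth * escape_bound k m.+1 + death * escape_bound k m.-1) <=
  (3 * birth + m%:R * (birth + death)) * escape_bound k.+1 m.
Proof.
have [w1 w2] := hw 0.
have death0 : 0 <= death by rewrite addr_ge0 ?fine_ge0 ?mulr_ge0.
case: m => [|p]; first by rewrite mul0r /escape_bound expr2 !(mul0r, addr0, mulr0).
rewrite /escape_bound/= addSn -addnS.
move: (death) death0 (birth) w2 => mu mu0 la la0.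
set P : R := p%:R; have P0 : 0 <= P by [].
have -> : p.+1%:R = P + 1 :> R by rewrite -natr1.
have -> : p.+2%:R = P + 2 :> R by rewrite -addn2 natrD.
rewrite !natrD; set K : R := k%:R; have K0 : 0 <= K by [].
have -> : p.+2%:R = P + 2 :> R by rewrite -addn2 natrD.
rewrite -/P.
have death_step : P ^+ 2 / (K + P) <= (P + 1) ^+ 2 / (K + (P + 2)).
  have [P1|] := ltP 0 P; last first.
    move=> P1; have -> : P = 0 by lra.
    by rewrite expr0n mul0r divr_ge0 ?exprn_ge0//; lra.
  rewrite ler_pdivrMr; last by lra.
  rewrite mulrAC ler_pdivlMr; last by lra.
  by nra.
have birth_step (X : R) : 0 <= X ->
    (P + 1) * (la * ((P + 2) ^+ 2 * X)) <=
    (3 * la + (P + 1) * la) * ((P + 1) ^+ 2 * X).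
  move=> X0; rewrite -subr_ge0.
  rewrite [leRHS](_ : _ = la * X * ((P + 1) * P)); last by ring.
  by rewrite !mulr_ge0//; lra.
have := birth_step _ (_ : 0 <= (K + (P + 2))^-1).
rewrite invr_ge0 => /(_ ltac:(lra)).
have := birth_step _ (_ : 0 <= M%:R^-1).
rewrite invr_ge0 => /(_ ltac:(by [])).
have : (P + 1) * mu * (P ^+ 2 / (K + P)) <=
       (P + 1) * mu * ((P + 1) ^+ 2 / (K + (P + 2))).
  by rewrite ler_wpM2l// mulr_ge0//; lra.
have : (P + 1) * mu * (P ^+ 2 / M%:R) <= (P + 1) * mu * ((P + 1) ^+ 2 / M%:R).
  rewrite ler_wpM2l//; first by rewrite mulr_ge0//; lra.
  by rewrite ler_wpM2r ?invr_ge0//; nra.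
move: ((K + (P + 2))^-1) ((K + P)^-1) (M%:R^-1) => X Y Z.
by lra.
Qed.

(* The error term [escape_bound] accounts for the histories with more than k
   jumps or ending with at least M particles; it is stable under the backward
   equation because a birth keeps [k + m] constant. *)
Lemma at0_moment_ge k m (t : R) : 0 <= t ->
  m%:R * expR ((birth - death) * t) <=
  W k m t + escape_bound k m * expR (3 * birth * t).
Proof.
have [w1 w2] := hw 0.
have death0 : 0 <= death by rewrite addr_ge0 ?fine_ge0 ?mulr_ge0.
elim: k m t => [|k IH] m t t0.
  (* At level 0 [W] vanishes, and [escape_bound 0 m] is at least [m]. *)
  rewrite /partial_moment big1 ?add0r; last by move=> i _; rewrite mulr0.
  apply: ler_pM => //; rewrite ?expR_ge0//.
    rewrite /escape_bound add0n expr2 -mulrA.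
    have [->|m0] := eqVneq m 0%N; first by rewrite !mul0r addr0.
    by rewrite divff ?pnatr_eq0// mulr1 lerDl divr_ge0// mulr_ge0.
  by rewrite ler_expR ler_wpM2r//; lra.
pose D r := W k.+1 m r + escape_bound k.+1 m * expR (3 * birth * r) -
  m%:R * expR ((birth - death) * r).
suff : 0 <= D t by rewrite /D subr_ge0.
have dD (r : R) := is_deriveB (is_deriveD
  (partial_momentS_ode R d kappa 0 w at0_configs k (at0 m) r)
  (is_derive_scaler _ (escape_bound k.+1 m) _ _ _ (is_derive_expRM _ (3 * birth) r)))
  (is_derive_scaler _ m%:R _ _ _ (is_derive_expRM _ (birth - death) r)).
apply: (linear_ode_ge0 _ (m%:R * (birth + death)) D _ _ t0 dD).
  move=> r r0 _.
  rewrite (jumps_at0 m (fun s => partial_moment R d kappa 0 w at0_configs k s r)).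
  rewrite exit_rate_at0.
  have IHS := IH m.+1 r r0.
  have IHP := IH m.-1 r r0.
  have ES : m%:R * (birth * (m.+1%:R * expR ((birth - death) * r) -
       escape_bound k m.+1 * expR (3 * birth * r)) +
      death * (m.-1%:R * expR ((birth - death) * r) -
       escape_bound k m.-1 * expR (3 * birth * r))) <=
      m%:R * (birth * W k m.+1 r + death * W k m.-1 r).
    by rewrite ler_wpM2l// lerD// ler_wpM2l// lerBlDr.
  have sup := ler_wpM2r (expR_ge0 (3 * birth * r)) (escape_bound_supersolution k m).
  (* At [m = 0] the truncated predecessor differs from [m - 1]; the factor [m] hides this. *)
  have mE : (m%:R : R) * m.-1%:R = m%:R * (m%:R - 1).
    by case: (m) => [|p]; rewrite ?mul0r//=; congr (_ * _); rewrite -natr1 addrK.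
  have mS : m.+1%:R = m%:R + 1 :> R by rewrite -natr1.
  rewrite /D.
  move: ES sup; rewrite mS.
  move: (W k m.+1 r) (W k m.-1 r) (W k.+1 m r) => W1 W2 W3.
  move: (expR (3 * birth * r)) (expR ((birth - death) * r)) => E1 E2.
  move: (escape_bound k m.+1) (escape_bound k m.-1) (escape_bound k.+1 m) => e1 e2 e3.
  move: mE; move: (m.-1%:R : R) (m%:R : R) => p q pq ES sup.
  rewrite [leRHS](_ : _ =
    (q * (birth * W1 + death * W2) - (q * (birth * ((q + 1) * E2 - e1 * E1) +
       death * (p * E2 - e2 * E1)))) +
    ((3 * birth + q * (birth + death)) * e3 * E1 -
       q * (birth * e1 + death * e2) * E1) + death * E2 * (q * p - q * (q - 1))).
    by rewrite pq subrr mulr0 addr0 addr_ge0// subr_ge0.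
  ring.
rewrite /D !mulr0 !expR0 !mulr1 subr_ge0.
have := at0_moment0 k m.
have : 0 <= (m%:R : R) ^+ 2 / (k.+1 + m)%:R by rewrite divr_ge0 ?exprn_ge0.
by rewrite /escape_bound; lra.
Qed.

End SingleSite.

Lemma first_moment_ge (R : realType) (d : nat) (kappa : R) (w : field R d) (t : R) :
  0 <= kappa -> field_range w -> 0 < t -> ((w 0%R).1 < +oo)%E ->
  ((expR (((w 0%R).2 - (fine (w 0%R).1 + (2 * d)%:R * kappa)) * t))%:E <=
   first_moment kappa w 0%R t)%E.
Proof.
move=> kappa0 hw t0 w0fin; set c := _ - _.
apply: (@le_trans _ _ (first_moment_box kappa 0 w 0 t)); last first.
  by apply: ereal_sup_ubound; exists 0%N.
rewrite /first_moment_box /initial_config gt_eqF//= /alive in_box0_origin w0fin/=.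
set B := esum _ _; set E := expR (3 * (w 0).2 * t).
(* With [k = M = N.+1] and one initial particle, each error term is at most [E / N.+1]. *)
have hB N : ((expR (c * t) - 2 * E / N.+1%:R)%:E <= B)%E.
  have uA := at0_configs_uniq d N.+1.
  apply: le_trans (expected_size_ge R d kappa 0 w [:: 0] t _ N (ltW t0) uA).
  rewrite lee_fin.
  have := at0_moment_ge R d kappa w kappa0 hw N.+1 isT N.+1 1 t (ltW t0).
  rewrite mul1r -/c -/E /escape_bound expr1n !mul1r.
  have : (N.+1 + 1)%:R^-1 <= N.+1%:R^-1 :> R.
    by rewrite lef_pV2 ?posrE ?ltr0n// ?ler_nat ?addn1.
  have : 0 <= E by exact: expR_ge0.
  move: (N.+1%:R^-1) ((N.+1 + 1)%:R^-1) => X Y E0 YX.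
  have : Y * E <= X * E by rewrite ler_wpM2r.
  by lra.
have cvgE : (expR (c * t) - 2 * E / N.+1%:R)%:E @[N --> \oo] --> (expR (c * t))%:E.
  apply: cvg_EFin; first by near=> N.
  rewrite -[X in _ --> X]subr0; apply: cvgB; first exact: cvg_cst.
  rewrite -[X in _ --> X](mulr0 (2 * E)); apply: cvgM; first exact: cvg_cst.
  exact: cvg_harmonic.
rewrite -(cvg_lim _ cvgE)//; apply: lime_le.
  by apply/cvg_ex; eexists; exact: cvgE.
by near=> N; exact: hB.
Unshelve. all: by end_near. Qed.

(** * Average over the environment *)

Section Averaged.
Variables (R : realType) (d : nat) (kappa : R).
Variables (disp : measure_display) (T : measurableType disp) (mu : probability T R).
Variable w : Zd d -> {RV mu >-> (\bar R * R)%type}.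
Hypotheses (kappa0 : 0 <= kappa) (hrange : forall o, field_range (sample w o)).
Hypothesis hid : identically_distributed w.

Local Notation rate := ((2 * d)%:R * kappa).

(** Written as a function of the field value at one site, so that its mean depends only on the law
    of that value. *)
Definition mgf_weight (t : R) (p : \bar R * R) : R :=
  if p.1 == +oo%E then 0 else expR (t * (p.2 - fine p.1)).

Lemma mgf_weight_measurable t : measurable_fun setT (mgf_weight t).
Proof.
apply: measurable_fun_ifT.
- by apply: measurable_fun_eqe; [exact: measurable_fst|exact: measurable_cst].
- exact: measurable_cst.
- apply: measurableT_comp => //; apply: measurable_funM; first exact: measurable_cst.
  apply: measurable_funB; first exact: measurable_snd.
  by apply: measurableT_comp measurable_fst; exact: fine_measurable.
Qed.

Lemma mgf_weight_ge0 t p : 0 <= mgf_weight t p.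
Proof. by rewrite /mgf_weight; case: ifP => // _; exact: expR_ge0. Qed.

Lemma expeR_potential (v : field R d) (t : R) x : field_range v -> 0 < t ->
  expeR (potential v x * t%:E)%E = (mgf_weight t (v x))%:E.
Proof.
move=> hv t0; have [v1 _] := hv x.
rewrite /mgf_weight /potential; case: eqP => [->|/eqP v1y].
  by rewrite /= addeNy mulNyr gtr0_sg// mul1e.
have v1fin : (v x).1 \is a fin_num by rewrite ge0_fin_numE// ltey.
by rewrite -[in LHS](fineK v1fin) -EFinB -EFinM/= mulrC.
Qed.

Lemma site_mgf_weight (o : T) (t : R) x : 0 < t ->
  site_mgf R d (sample w o) t x = mgf_weight t (w x o).
Proof. by move=> t0; rewrite /site_mgf expeR_potential. Qed.

Lemma mean_mgf_weight (t : R) x : 0 < t ->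
  (\int[mu]_o (mgf_weight t (w x o))%:E = mean_exp w t)%E.
Proof.
move=> t0.
have dist y : (\int[mu]_o (mgf_weight t (w y o))%:E =
    \int[distribution mu (w y)]_p (mgf_weight t p)%:E)%E.
  rewrite ge0_integral_distribution//.
    by apply/measurable_EFinP; exact: mgf_weight_measurable.
  by move=> p; rewrite lee_fin mgf_weight_ge0.
rewrite dist (eq_measure_integral (distribution mu (w 0))); last first.
  by move=> A mA _; exact: hid.
rewrite -dist /mean_exp; apply: eq_integral => o _.
by rewrite /v0 expeR_potential.
Qed.

Lemma site_mgf_measurable (t : R) x : 0 < t ->
  measurable_fun setT (fun o => site_mgf R d (sample w o) t x).
Proof.
move=> t0; under eq_fun do rewrite site_mgf_weight//.
exact: measurableT_comp (mgf_weight_measurable t) (measurable_funPT (w x)).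
Qed.

Lemma iter_nbr_sum_measurable (t : R) i x : 0 < t ->
  measurable_fun setT (fun o => iter i (nbr_sum R d) (site_mgf R d (sample w o) t) x).
Proof.
move=> t0; elim: i x => [|i IH] x; first exact: site_mgf_measurable.
exact: measurable_sum.
Qed.

(** All path endpoints have the same mean, so averaging leaves the number of paths times
    [mean_exp]. *)
Lemma mean_iter_nbr_sum (t : R) i x : 0 < t ->
  (\int[mu]_o (iter i (nbr_sum R d) (site_mgf R d (sample w o) t) x)%:E =
   (iter i (nbr_sum R d) (fun=> 1) x)%:E * mean_exp w t)%E.
Proof.
move=> t0; elim: i x => [|i IH] x.
  rewrite /= mul1e -(mean_mgf_weight t x t0).
  by apply: eq_integral => o _; rewrite site_mgf_weight.
rewrite !iterS; under eq_integral do rewrite /nbr_sum -sumEFin.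
rewrite ge0_integral_sum//; last first.
- move=> y o _; rewrite lee_fin iter_nbr_sum_ge0// => z; exact: site_mgf_ge0.
- by move=> y; apply/measurable_EFinP; exact: iter_nbr_sum_measurable.
under eq_bigr do rewrite IH.
rewrite -ge0_sume_distrl.
  by rewrite sumEFin.
by move=> y _; rewrite lee_fin iter_nbr_sum_ge0.
Qed.

Lemma mean_occupation (t : R) j x : 0 < t ->
  (\int[mu]_o (occupation R d kappa (site_mgf R d (sample w o) t) j x t)%:E =
   (occupation R d kappa (fun=> 1) j x t)%:E * mean_exp w t)%E.
Proof.
move=> t0; have pt0 i := path_time_ge0 R d kappa kappa0 i t (ltW t0).
have m0 i y o : 0 <= iter i (nbr_sum R d) (site_mgf R d (sample w o) t) y.
  by rewrite iter_nbr_sum_ge0// => z; exact: site_mgf_ge0.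
have mi i y : measurable_fun setT
    (fun o => (iter i (nbr_sum R d) (site_mgf R d (sample w o) t) y)%:E).
  by apply/measurable_EFinP; exact: iter_nbr_sum_measurable.
under eq_integral do rewrite /occupation -sumEFin.
rewrite ge0_integral_sum//; last first.
- by move=> i o _; rewrite lee_fin mulr_ge0.
- move=> i; under eq_fun do rewrite EFinM; exact: measurable_funeM.
under eq_bigr => i _.
  under eq_integral do rewrite EFinM.
  rewrite ge0_integralZl_EFin//; last by move=> o _; rewrite lee_fin.
  rewrite mean_iter_nbr_sum// muleA -EFinM.
  over.
rewrite -ge0_sume_distrl; first by rewrite sumEFin.
by move=> i _; rewrite lee_fin mulr_ge0// iter_nbr_sum_ge0.
Qed.

Lemma mean_exp_ge0 (t : R) : (0 <= mean_exp w t)%E.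
Proof. by apply: integral_ge0 => o _; exact: expeR_ge0. Qed.

Lemma first_moment_ge0 (v : field R d) (t : R) x : 0 < t ->
  (0 <= first_moment kappa v x t)%E.
Proof.
move=> t0; apply: (@le_trans _ _ (first_moment_box kappa 0 v x t)); last first.
  by apply: ereal_sup_ubound; exists 0%N.
have := expected_size_ge R d kappa 0 v (initial_config 0 v x t) t [::] 0 (ltW t0) isT.
by rewrite /partial_moment big_nil.
Qed.

(** The bound of [first_moment_le] increases with the number of steps, so monotone convergence
    averages it; the total path time, at most [t], cancels the division by [t]. *)
Lemma mean_first_moment_le (t : R) : 0 < t ->
  (mean_first_moment w kappa t <= mean_exp w t)%E.
Proof.
move=> t0.
pose g j o := (occupation R d kappa (site_mgf R d (sample w o) t) j 0 t / t)%:E.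
have g0 j o : (0 <= g j o)%E.
  rewrite lee_fin divr_ge0 ?(ltW t0)// occupation_ge0 ?(ltW t0)// => z.
  exact: site_mgf_ge0.
have mg j : measurable_fun setT (g j).
  apply/measurable_EFinP; apply: measurable_funM; last exact: measurable_cst.
  apply: measurable_sum => i; apply: measurable_funM; first exact: measurable_cst.
  exact: iter_nbr_sum_measurable.
have ndg o : {homo g ^~ o : n m / (n <= m)%N >-> (n <= m)%E}.
  apply/nondecreasing_seqP => j; rewrite lee_fin ler_wpM2r ?invr_ge0 ?(ltW t0)//.
  rewrite /occupation big_ord_recr/= lerDl mulr_ge0 ?path_time_ge0 ?(ltW t0)//.
  by rewrite iter_nbr_sum_ge0// => z; exact: site_mgf_ge0.
apply: (@le_trans _ _ (\int[mu]_o limn (g ^~ o))%E).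
  apply: le_integral_setT_nonmeasurable => o; first exact: first_moment_ge0.
  apply: le_trans (first_moment_le R d kappa kappa0 _ _ _ (hrange o) t0) _.
  rewrite le_eqVlt; apply/orP; left; apply/eqP/esym/cvg_lim => //.
  exact: ereal_nondecreasing_cvgn.
rewrite monotone_convergence//; apply: lime_le.
  apply: ereal_nondecreasing_is_cvgn => i j ij; apply: ge0_le_integral => // o _.
  exact: ndg.
near=> j.
rewrite /g; under eq_integral do rewrite mulrC EFinM.
rewrite ge0_integralZl_EFin ?invr_ge0 ?(ltW t0)//; last 2 first.
- by move=> o _; rewrite lee_fin occupation_ge0 ?(ltW t0)// => z; exact: site_mgf_ge0.
- apply/measurable_EFinP; apply: measurable_sum => i.
  apply: measurable_funM; first exact: measurable_cst.
  exact: iter_nbr_sum_measurable.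
rewrite mean_occupation// muleA -EFinM -[leRHS]mul1e.
apply: lee_wpmul2r; first exact: mean_exp_ge0.
by rewrite lee_fin mulrC ler_pdivrMr// mul1r occupation_cst1_le// ltW.
Unshelve. all: by end_near. Qed.

Lemma mean_first_moment_ge (t : R) : 0 < t ->
  ((expR (- rate * t))%:E * mean_exp w t <= mean_first_moment w kappa t)%E.
Proof.
move=> t0; rewrite -(mean_mgf_weight t 0 t0) -ge0_integralZl_EFin ?expR_ge0//; last 2 first.
- by move=> o _; rewrite lee_fin mgf_weight_ge0.
- apply/measurable_EFinP.
  exact: measurableT_comp (mgf_weight_measurable t) (measurable_funPT (w 0)).
apply: le_integral_setT_nonmeasurable => o.
  by rewrite -EFinM lee_fin mulr_ge0 ?expR_ge0 ?mgf_weight_ge0.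
(* Where [v_-] is infinite at the origin the lower bound is 0. *)
rewrite -EFinM /mgf_weight; case: eqP => [_|/eqP w1y].
  by rewrite mulr0; exact: first_moment_ge0.
have wfin : ((sample w o 0%R).1 < +oo)%E by rewrite ltey.
apply: le_trans (first_moment_ge R d kappa _ _ kappa0 (hrange o) t0 wfin).
rewrite lee_fin -expRD ler_expR /sample le_eqVlt; apply/orP; left; apply/eqP; ring.
Qed.

End Averaged.

(** * Bounds on [H] by the Legendre transform of the tail exponent *)

Section LogMoment.
Variables (R : realType) (d : nat).
Variables (disp : measure_display) (T : measurableType disp) (mu : probability T R).
Variables (w : Zd d -> {RV mu >-> (\bar R * R)%type}) (h : R -> R).
Hypothesis hrange : forall o, field_range (sample w o).
Hypothesis hexp : forall t : R, 0 <= t -> (mean_exp w t < +oo)%E.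
Hypothesis htail : forall x : R, 0 < x ->
  mu [set o | (x%:E < v0 w o)%E] = (expR (- h x))%:E.

Lemma v0_measurable : measurable_fun setT (v0 w).
Proof.
have mw := measurable_funPT (w 0).
apply: emeasurable_funB.
  apply/measurable_EFinP; apply: measurableT_comp mw; exact: measurable_snd.
by apply: measurableT_comp mw; exact: measurable_fst.
Qed.

Lemma v0_lty o : (v0 w o < +oo)%E.
Proof.
have [w1 _] := hrange o 0; rewrite /v0 /potential.
by case: (sample w o 0%R).1 w1 => [r||]//= _; rewrite ltry.
Qed.

Lemma tail_measurable (x : R) : measurable [set o | (x%:E < v0 w o)%E].
Proof.
rewrite -[X in measurable X]setTI.
by apply: emeasurable_fun_o_infty => //; exact: v0_measurable.
Qed.

Lemma tail_exponent_ge0 (x : R) : 0 < x -> 0 <= h x.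
Proof.
move=> x0; have := probability_le1 mu (tail_measurable x).
by rewrite htail// lee_fin -expR0 ler_expR oppr_le0.
Qed.

Lemma integral_scaled_indic (c : R) (A : set T) : 0 <= c -> measurable A ->
  (\int[mu]_o (c * \1_A o)%:E = c%:E * mu A)%E.
Proof.
move=> c0 mA; under eq_integral do rewrite EFinM.
rewrite ge0_integralZl_EFin//; first by rewrite integral_indic// setIT.
by apply/measurable_EFinP; exact: measurable_indic.
Qed.

(** Markov's inequality for the exponential of [t * v(0)]. *)
Lemma mean_exp_tail_ge (t x : R) : 0 < t -> 0 < x ->
  ((expR (t * x - h x))%:E <= mean_exp w t)%E.
Proof.
move=> t0 x0; rewrite expRD EFinM -htail// -integral_scaled_indic ?expR_ge0//; last first.
  exact: tail_measurable.
apply: le_integral_setT_nonmeasurable => o; first by rewrite lee_fin mulr_ge0 ?expR_ge0.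
rewrite indicE; case: (boolP (o \in _)) => [|_]; last by rewrite mulr0 expeR_ge0.
rewrite inE/= mulr1; move: (v0 w o) (v0_lty o) => [r||]//= _.
by rewrite lte_fin => xr; rewrite lee_fin ler_expR mulrC ler_wpM2r// ltW.
Qed.

Lemma mean_exp_fin (t : R) : 0 < t -> mean_exp w t \is a fin_num.
Proof.
move=> t0; rewrite ge0_fin_numE; first by rewrite hexp// ltW.
exact: mean_exp_ge0.
Qed.

Lemma mean_exp_gt0 (t : R) : 0 < t -> 0 < fine (mean_exp w t).
Proof.
move=> t0; rewrite -lte_fin fineK ?mean_exp_fin//.
by apply: lt_le_trans (mean_exp_tail_ge t 1 t0 ltr01); rewrite lte_fin expR_gt0.
Qed.

Lemma H_tail_ge (t x : R) : 0 < t -> 0 < x -> t * x - h x <= H w t.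
Proof.
move=> t0 x0; rewrite -ler_expR /H lnK ?posrE ?mean_exp_gt0//.
by rewrite -lee_fin fineK ?mean_exp_fin// mean_exp_tail_ge.
Qed.

(** On the layer [n + 1 < v(0) <= n + 2] the exponential is at most [expR s] times the [n]-th term;
    the constant 1 handles [v(0) <= 1]. *)
Lemma expeR_layers (s : R) o : 0 < s ->
  (expeR (v0 w o * s%:E) <= (expR s)%:E * (1 + \sum_(0 <= n <oo)
     (expR (s * n.+1%:R) * \1_[set o | (n.+1%:R%:E < v0 w o)%E] o)%:E))%E.
Proof.
move=> s0.
pose g n := (expR (s * n.+1%:R) * \1_[set o | (n.+1%:R%:E < v0 w o)%E] o)%:E.
rewrite -/g.
have g0 n : (0 <= g n)%E by rewrite lee_fin mulr_ge0 ?expR_ge0.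
have S0 : (0 <= \sum_(0 <= n <oo) g n)%E by exact: nneseries_ge0.
case vE : (v0 w o) (v0_lty o) => [r||]//= _; last first.
  by rewrite mulNyr gtr0_sg// mul1e/= mule_ge0 ?lee_fin ?expR_ge0// adde_ge0.
have [r1|r1] := leP r 1.
  apply: (@le_trans _ _ ((expR s)%:E * 1)%E).
    by rewrite mule1 lee_fin ler_expR -[leRHS]mul1r ler_wpM2r// ltW.
  by apply: lee_wpmul2l; rewrite ?lee_fin ?expR_ge0// leeDl.
have exr : exists n, r <= n%:R.
  by exists (Num.truncn r).+1; rewrite ltW// truncnS_gt.
(* The least natural number not below [r] is at least 2, because [r > 1]. *)
case: (ex_minnP exr) => -[|[|n]] rn minn.
- by have := lt_le_trans r1 rn; rewrite ltr10.
- by have := lt_le_trans r1 rn; rewrite ltxx.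
have nr : n.+1%:R < r.
  by rewrite ltNge; apply/negP => /minn; rewrite ltnn.
apply: (@le_trans _ _ ((expR s)%:E * g n)%E).
  rewrite /g indicE mem_set/= ?vE ?lte_fin// mulr1 -EFinM lee_fin -expRD ler_expR.
  by have := ler_wpM2r (ltW s0) rn; rewrite -(natr1 n.+1); lra.
apply: lee_wpmul2l; rewrite ?lee_fin ?expR_ge0//.
apply: (@le_trans _ _ (\sum_(0 <= i <oo) g i)%E); last by rewrite leeDr.
apply: le_trans (nneseries_lim_ge n.+1 _) => //.
by rewrite big_nat_recr//= leeDr// sume_ge0.
Qed.

Lemma expRN1_half : expR (- 1) <= 2^-1 :> R.
Proof.
rewrite expRN lef_pV2 ?posrE ?expR_gt0//.
by apply: le_trans (expR_ge1Dx _); lra.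
Qed.

(** The reserve [t - s >= 1] gives the [n]-th layer an extra factor [expR (- (n + 1))], at most
    [2^-(n + 1)], so the layers sum to at most [expR B]. *)
Lemma mean_exp_le (s t B : R) : 0 < s -> s + 1 <= t -> 0 <= B ->
  (forall x, 0 < x -> t * x - h x <= B) ->
  (mean_exp w s <= (expR s * (1 + expR B))%:E)%E.
Proof.
move=> s0 st B0 hB.
pose A n := [set o | (n.+1%:R%:E < v0 w o)%E] : set T.
have mA n : measurable (A n) by exact: tail_measurable.
pose g n o := (expR (s * n.+1%:R) * \1_(A n) o)%:E.
have g0 n o : (0 <= g n o)%E by rewrite lee_fin mulr_ge0 ?expR_ge0.
have mg n : measurable_fun setT (g n).
  apply/measurable_EFinP; apply: measurable_funM; first exact: measurable_cst.
  exact: measurable_indic.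
have mS : measurable_fun setT (fun o => \sum_(0 <= n <oo) g n o)%E.
  by apply: ge0_emeasurable_sum => // n o _ _; exact: g0.
have intS : (\int[mu]_o (\sum_(0 <= n <oo) g n o) <= (expR B)%:E)%E.
  rewrite integral_nneseries//.
  apply: lime_le; first by apply: is_cvg_nneseries => n _ _; exact: integral_ge0.
  near=> N.
  apply: (@le_trans _ _ (expR B * (1 - 2^-1 ^+ N))%:E); last first.
    by rewrite lee_fin ler_piMr ?expR_ge0// gerBl exprn_ge0.
  elim: (N) => [|m IH]; first by rewrite big_geq// expr0 subrr mulr0.
  rewrite big_nat_recr//=.
  have -> : expR B * (1 - 2^-1 ^+ m.+1) =
      expR B * (1 - 2^-1 ^+ m) + expR B * 2^-1 ^+ m.+1.
    by rewrite exprS; lra.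
  rewrite EFinD leeD// integral_scaled_indic ?expR_ge0// htail// -EFinM lee_fin.
  rewrite -expRD; apply: (@le_trans _ _ (expR (B + m.+1%:R * - 1))).
    have := hB m.+1%:R (ltr0Sn _ _).
    have : s * m.+1%:R + m.+1%:R <= t * m.+1%:R.
      by rewrite -[X in _ + X]mul1r -mulrDl ler_wpM2r.
    by rewrite ler_expR; lra.
  rewrite expRD ler_wpM2l ?expR_ge0// expRM_natl.
  by rewrite lerXn2r ?nnegrE ?expR_ge0// ?invr_ge0// expRN1_half.
apply: (@le_trans _ _ (\int[mu]_o ((expR s)%:E * (1 + \sum_(0 <= n <oo) g n o)))%E).
  by apply: le_integral_setT_nonmeasurable => o; [exact: expeR_ge0|exact: expeR_layers].
have S0 o : (0 <= \sum_(0 <= n <oo) g n o)%E by exact: nneseries_ge0.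
rewrite ge0_integralZl_EFin ?expR_ge0//; last 2 first.
- by move=> o _; rewrite adde_ge0.
- by apply: emeasurable_funD.
rewrite ge0_integralD//.
rewrite [leRHS]EFinM EFinD; have -> : (\int[mu]_(o in setT) (1 : \bar R) = 1)%E.
  by rewrite integral_cst// mul1e; exact: probability_setT.
by apply: lee_wpmul2l; rewrite ?lee_fin ?expR_ge0// leeD2l.
Unshelve. all: by end_near. Qed.

Lemma H_le (s t B : R) : 0 < s -> s + 1 <= t -> 0 <= B ->
  (forall x, 0 < x -> t * x - h x <= B) -> H w s <= s + 1 + B.
Proof.
move=> s0 st B0 hB; rewrite -ler_expR /H lnK ?posrE ?mean_exp_gt0//.
rewrite -lee_fin fineK ?mean_exp_fin//.
apply: le_trans (mean_exp_le _ _ _ s0 st B0 hB) _.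
rewrite lee_fin -addrA expRD ler_wpM2l ?expR_ge0// expRD.
have e2 : 2 <= expR 1 :> R by apply: le_trans (expR_ge1Dx _); lra.
have eB : 1 <= expR B by rewrite -expR0 ler_expR.
by nra.
Qed.

End LogMoment.

(** * Regular variation of the cumulant generating function *)

Lemma near_pinfty_scale (R : realType) (c : R) (P : R -> Prop) : 0 < c ->
  (\forall t \near +oo, P t) -> \forall t \near +oo, P (c * t).
Proof.
move=> c0 [M [Mreal hM]]; exists (M / c); split; first exact: num_real.
by move=> t Mt; apply: hM; rewrite mulrC -ltr_pdivrMr.
Qed.

Section LegendreRegularVariation.
Variables (R : realType) (L h : R -> R) (rho : R).
Hypotheses (rho1 : 1 < rho) (hreg : regularly_varying h rho).
Hypothesis h_ge0 : forall x : R, 0 < x -> 0 <= h x.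
Hypothesis L_ge : forall t x : R, 0 < t -> 0 < x -> t * x - h x <= L t.
Hypothesis L_le : forall s t B : R, 0 < s -> s + 1 <= t -> 0 <= B ->
  (forall x : R, 0 < x -> t * x - h x <= B) -> L s <= s + 1 + B.

Local Notation beta := (rho / (rho - 1)).

Lemma conjugate_index_gt1 : 1 < beta.
Proof. by rewrite ltr_pdivlMr ?subr_gt0// mul1r gtrBl. Qed.

(** The lower bound at the fixed point [x = |K| + 1] is a line of slope greater than [K]. *)
Lemma superlinear (K : R) : \forall t \near +oo, K * t <= L t.
Proof.
have x0 : 0 < `|K| + 1 by have := normr_ge0 K; lra.
near=> t.
have t0 : 0 < t by near: t; exact: nbhs_pinfty_gt.
apply: le_trans (L_ge t _ t0 x0); rewrite lerBrDr.
have -> : t * (`|K| + 1) = `|K| * t + t by ring.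
apply: lerD; first by rewrite ler_wpM2r ?ler_norm// ltW.
by near: t; apply: nbhs_pinfty_ge; exact: num_real.
Unshelve. all: by end_near. Qed.

(* The substitution [x = b y] with [b = a `^ (1 / (rho - 1))] turns both [a t x]
   and [h x] into [a `^ beta] times their values at [y], up to the factor r. *)
Lemma scaled_le (a r : R) : 0 < a -> 1 < r ->
  \forall t \near +oo, L (a * t) <= a `^ beta * L (r ^+ 2 * t).
Proof.
move=> a0 r1; have r0 : 0 < r by lra.
pose b := a `^ (rho - 1)^-1.
have b0 : 0 < b by exact: powR_gt0.
have rho10 : rho - 1 != 0 by rewrite subr_eq0 gt_eqF.
have abE : a * b = a `^ beta.
  rewrite /b -{1}(powRr1 (ltW a0)) -powRD ?(gt_eqF a0) ?implybT//.
  by congr (_ `^ _); field.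
have brho : b `^ rho = a `^ beta by rewrite /b -powRrM mulrC.
have ab0 : 0 < a `^ beta by exact: powR_gt0.
have : \forall y \near +oo, a `^ beta / r <= h (b * y) / h y.
  have /cvgrPdist_le := hreg b b0; rewrite brho.
  move=> /(_ (a `^ beta - a `^ beta / r)) H.
  have gap : 0 < a `^ beta - a `^ beta / r.
    by rewrite subr_gt0 ltr_pdivrMr// ltr_pMr.
  have {}H := H gap; near=> y.
  have : `|a `^ beta - h (b * y) / h y| <= a `^ beta - a `^ beta / r by near: y.
  by rewrite ler_norml; lra.
move=> [Y [_ hY]].
(* A positive threshold above [Y]: nonnegativity of [h] is known only at positive arguments. *)
pose Y0 := `|Y| + 1.
have Y00 : 0 < Y0 by rewrite /Y0; have := normr_ge0 Y; lra.
have hY0 y : Y0 <= y -> a `^ beta / r * h y <= h (b * y).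
  move=> Yy; have y0 : 0 < y by lra.
  have hy := h_ge0 y y0.
  have := hY y; rewrite (lt_le_trans _ Yy); last first.
    by rewrite /Y0; have := ler_norm Y; lra.
  (* If [h y = 0] the ratio carries no information, and nonnegativity of [h] suffices. *)
  move=> /(_ isT); move: hy; rewrite le_eqVlt => /predU1P[<- _|hy].
    by rewrite mulr0 h_ge0// mulr_gt0.
  by rewrite ler_pdivlMr.
pose C := a `^ beta / r.
have C0 : 0 < C by rewrite divr_gt0.
(* Makes [(a + 1) * t] at most the gap between a^beta and [C] times [L (r ^+ 2 * t)], which absorbs
   the linear error. *)
pose K := (a + 1) / (r ^+ 2 * (a `^ beta - C)).
have Cgap : 0 < a `^ beta - C by rewrite subr_gt0 ltr_pdivrMr// ltr_pMr.
have r20 : 0 < r ^+ 2 by rewrite exprn_gt0.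
near=> t.
have t0 : 0 < t by near: t; exact: nbhs_pinfty_gt.
have t1 : 1 <= t by near: t; apply: nbhs_pinfty_ge; exact: num_real.
have t2 : (a * (r - 1))^-1 <= t by near: t; apply: nbhs_pinfty_ge; exact: num_real.
have LY : Y0 * (r ^+ 2 * t) <= L (r ^+ 2 * t).
  by near: t; apply: (near_pinfty_scale _ _ (fun t => Y0 * t <= L t)) => //; exact: superlinear.
have LK : K * (r ^+ 2 * t) <= L (r ^+ 2 * t).
  by near: t; apply: (near_pinfty_scale _ _ (fun t => K * t <= L t)) => //; exact: superlinear.
have L0 : 0 <= L (r ^+ 2 * t).
  by apply: le_trans LY; rewrite !mulr_ge0// ltW.
(* [L_le] is used with the larger slope [r * a * t]; the spare [a * (r - 1) * t] is at least 1. *)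
have : L (a * t) <= a * t + 1 + C * L (r ^+ 2 * t).
  apply: (L_le _ (r * a * t)).
  - exact: mulr_gt0.
  - have : 1 <= a * (r - 1) * t.
      by rewrite mulrC -ler_pdivrMr ?div1r// mulr_gt0// subr_gt0.
    by lra.
  - by rewrite mulr_ge0// ltW.
  - move=> x x0; pose y := x / b.
    have xE : x = b * y by rewrite /y mulrC divfK// gt_eqF.
    have y0 : 0 < y by rewrite divr_gt0.
    have lhsE : r * a * t * (b * y) = C * (r ^+ 2 * t * y).
      by rewrite /C -abE; field; rewrite gt_eqF.
    (* Regular variation handles large [y]; superlinearity of [L] handles [y] below [Y0]. *)
    rewrite xE lhsE; have [Yy|yY] := leP Y0 y.
      apply: (@le_trans _ _ (C * (r ^+ 2 * t * y - h y))).
        by rewrite mulrBr lerB// hY0.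
      by rewrite ler_wpM2l ?(ltW C0)// L_ge// mulr_gt0.
    have := h_ge0 (b * y) (mulr_gt0 b0 y0).
    have : C * (r ^+ 2 * t * y) <= C * L (r ^+ 2 * t).
      rewrite ler_wpM2l ?(ltW C0)//; apply: le_trans LY.
      by rewrite mulrC ler_wpM2r ?mulr_ge0 ?(ltW r20)// ltW.
    by lra.
have KE : K * (r ^+ 2 * t) * (a `^ beta - C) = (a + 1) * t.
  by rewrite /K; field; rewrite !gt_eqF.
have := ler_wpM2r (ltW Cgap) LK; rewrite KE.
move: (L (a * t)) (L (r ^+ 2 * t)) => L1 L2.
by lra.
Unshelve. all: by end_near. Qed.

(** Taking [r] with r^(2 beta) equal to [1 + e] and rescaling [t] by [r ^+ 2] removes the dilation
    from [scaled_le]. *)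
Lemma scaled_upper (a e : R) : 0 < a -> 0 < e ->
  \forall t \near +oo, L (a * t) <= (1 + e) * a `^ beta * L t.
Proof.
move=> a0 e0; have beta1 := conjugate_index_gt1.
have beta0 : 0 < beta by exact: lt_trans beta1.
pose r := (1 + e) `^ (2 * beta)^-1.
have r1 : 1 < r.
  have : 1 `^ (2 * beta)^-1 < (1 + e) `^ (2 * beta)^-1.
    apply: gt0_ltr_powR; rewrite ?nnegrE; [|lra|lra|lra].
    by rewrite invr_gt0 mulr_gt0.
  by rewrite powR1.
have r0 : 0 < r by lra.
have rE : (r ^+ 2) `^ beta = 1 + e.
  rewrite /r -powR_mulrn ?powR_ge0// -!powRrM.
  rewrite (_ : _ * _ = 1) ?powRr1//; first by lra.
  by move: (beta) beta0 => B B0; field; rewrite gt_eqF.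
have r20 : 0 < r ^+ 2 by rewrite exprn_gt0.
have H := scaled_le (a * r ^+ 2) r (mulr_gt0 a0 r20) r1.
have r2V : 0 < (r ^+ 2)^-1 by rewrite invr_gt0.
have {}H := near_pinfty_scale _ _ (fun t => L (a * r ^+ 2 * t) <=
  (a * r ^+ 2) `^ beta * L (r ^+ 2 * t)) r2V H.
near=> t.
have : L (a * r ^+ 2 * ((r ^+ 2)^-1 * t)) <=
  (a * r ^+ 2) `^ beta * L (r ^+ 2 * ((r ^+ 2)^-1 * t)) by near: t.
rewrite powRM ?(ltW a0) ?(ltW r20)// rE mulrA mulfK ?gt_eqF//.
by rewrite mulrA divff ?gt_eqF// mul1r [a `^ _ * _]mulrC.
Unshelve. all: by end_near. Qed.

(** The lower bound is the upper bound for [a^-1], read at [a * t]. *)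
Lemma conjugate_regularly_varying : regularly_varying L beta.
Proof.
move=> a a0; have aV : 0 < a^-1 by rewrite invr_gt0.
have ab0 : 0 < a `^ beta by exact: powR_gt0.
apply/cvgrPdist_le => e e0.
pose e' := e / a `^ beta.
have e'0 : 0 < e' by rewrite divr_gt0.
have e'E : e = e' * a `^ beta by rewrite /e' divfK// gt_eqF.
have low := near_pinfty_scale _ _ (fun t => L (a^-1 * t) <=
  (1 + e') * a^-1 `^ beta * L t) a0 (scaled_upper _ _ aV e'0).
near=> t.
have t0 : 0 < t by near: t; exact: nbhs_pinfty_gt.
have Lt : 0 < L t.
  apply: lt_le_trans t0 _; rewrite -[leLHS]mul1r.
  by near: t; exact: superlinear.
have up : L (a * t) <= (1 + e') * a `^ beta * L t.
  by near: t; exact: scaled_upper.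
have : L (a^-1 * (a * t)) <= (1 + e') * a^-1 `^ beta * L (a * t) by near: t.
rewrite mulrA mulVf ?gt_eqF// mul1r.
have -> : a^-1 `^ beta = (a `^ beta)^-1.
  by rewrite -powR_inv1 ?ltW// -powRrM mulN1r powRN.
move=> lo; have {}up : L (a * t) / L t <= (1 + e') * a `^ beta.
  by rewrite ler_pdivrMr.
have {}lo : a `^ beta <= (1 + e') * (L (a * t) / L t).
  rewrite mulrA ler_pdivlMr// mulrC.
  by move: lo; rewrite mulrAC ler_pdivlMr.
rewrite ler_norml e'E; set q := _ / _ in up lo *.
by apply/andP; split; nra.
Unshelve. all: by end_near. Qed.

End LegendreRegularVariation.

(** * Second differences *)

Section PowerSlope.
Variables (R : realType) (b : R).
Hypothesis b1 : 1 < b.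

(** With [l = ln z], combine [1 + x < expR x] at [x = (b - 1) * l] and at [x = - l]. *)
Lemma powR_bernoulli (z : R) : 0 < z -> z != 1 -> 1 + b * (z - 1) < z `^ b.
Proof.
move=> z0 z1; pose l := ln z.
have l0 : l != 0 by rewrite ln_eq0.
have zE : z = expR l by rewrite /l lnK.
have zbE : z `^ b = z * expR ((b - 1) * l).
  by rewrite {2}zE -expRD /powR gt_eqF// -/l; congr expR; ring.
have h1 : 1 + (b - 1) * l < expR ((b - 1) * l).
  by apply: expR_gt1Dx; rewrite mulf_neq0// subr_eq0 gt_eqF.
have h2 : z * (1 - l) < 1.
  have : 1 + - l < expR (- l) by apply: expR_gt1Dx; rewrite oppr_eq0.
  by rewrite expRN -zE -(ltr_pM2l z0) divff ?gt_eqF.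
rewrite -(ltr_pM2l z0) -zbE in h1.
have b10 : 0 < b - 1 by rewrite subr_gt0.
have : (b - 1) * (z * (1 - l)) < (b - 1) * 1 by rewrite ltr_pM2l.
by lra.
Qed.

Lemma powR_tangent (x y : R) : 0 < x -> 0 < y -> x != y ->
  y `^ b + b * y `^ (b - 1) * (x - y) < x `^ b.
Proof.
move=> x0 y0 xy.
have yb0 : 0 < y `^ b by exact: powR_gt0.
have z0 : 0 < x / y by rewrite divr_gt0.
have z1 : x / y != 1.
  apply: contra_neq xy => h1; apply/eqP; rewrite -subr_eq0; apply/eqP.
  by rewrite -[x](@divfK _ y) ?gt_eqF// h1 mul1r subrr.
have := powR_bernoulli (x / y) z0 z1; rewrite -(ltr_pM2l yb0).
rewrite -powRM ?(ltW y0) ?(ltW z0)// [y * _]mulrC divfK ?gt_eqF//.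
apply: le_lt_trans; rewrite le_eqVlt; apply/orP; left; apply/eqP.
by rewrite -(mulr_powRB1 (ltW y0) (lt_trans ltr01 b1)); field; rewrite gt_eqF.
Qed.

Definition power_slope (u : R) : R := ((1 + u) `^ b - (1 + u)) / u.

(** A tangent separates the two chords issued from 1. It touches at the endpoint nearer to 1 when
    [u] and [v] have the same sign, and at 1 otherwise. *)
Lemma power_slope_lt (u v : R) : -1 < u -> u != 0 -> v != 0 -> u < v ->
  power_slope u < power_slope v.
Proof.
move=> u1 u0 v0 uv.
have slopeE s : s != 0 -> power_slope s = ((1 + s) `^ b - 1) / s - 1.
  by move=> s0; rewrite /power_slope; field.
rewrite !slopeE// ltrD2r.
have [x xE] : exists x, x = 1 + u by exists (1 + u).
have [y yE] : exists y, y = 1 + v by exists (1 + v).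
rewrite -xE -yE.
have x0 : 0 < x by lra.
have y0 : 0 < y by lra.
have xy : x != y by rewrite lt_eqF//; lra.
have yx : y != x by rewrite eq_sym.
have x1 : x != 1 by apply: contra_neq u0 => ?; lra.
have y1 : y != 1 by apply: contra_neq v0 => ?; lra.
have tx := powR_tangent _ _ ltr01 x0 (_ : 1 != x).
have ty := powR_tangent _ _ ltr01 y0 (_ : 1 != y).
rewrite eq_sym x1 powR1 in tx; rewrite eq_sym y1 powR1 in ty.
have {}tx := tx isT; have {}ty := ty isT.
have txy := powR_tangent _ _ x0 y0 xy.
have tyx := powR_tangent _ _ y0 x0 yx.
have bx := powR_bernoulli _ x0 x1.
have by' := powR_bernoulli _ y0 y1.
move: (x `^ b) (y `^ b) (b * x `^ (b - 1)) (b * y `^ (b - 1)) tx ty txy tyx bx by'.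
move=> X Y mx my tx ty txy tyx bx by'.
rewrite xE yE in tx ty txy tyx bx by'.
have [u_gt0|u_le0] := ltP 0 u.
  have v_gt0 : 0 < v by exact: lt_trans uv.
  rewrite ltr_pdivrMr// mulrAC ltr_pdivlMr//.
  have : (X - 1) * (v - u) < mx * u * (v - u).
    by rewrite ltr_pM2r ?subr_gt0//; lra.
  have : (X + mx * (v - u) - 1) * u < (Y - 1) * u.
    by rewrite ltr_pM2r//; lra.
  by lra.
have u_lt0 : u < 0 by rewrite lt_neqAle u0.
have [v_gt0|v_le0] := ltP 0 v.
  apply: (@lt_trans _ _ b); first by rewrite ltr_ndivrMr//; lra.
  by rewrite ltr_pdivlMr//; lra.
have v_lt0 : v < 0 by rewrite lt_neqAle v0.
rewrite ltr_ndivrMr// mulrAC ltr_ndivrMr//.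
have : my * v * (u - v) < (Y - 1) * (u - v).
  by rewrite ltr_nM2r ?subr_lt0//; lra.
have : (X - 1) * v < (Y + my * (u - v) - 1) * v.
  by rewrite ltr_nM2r//; lra.
by lra.
Qed.

Lemma power_slope_gt0 (u : R) : -1 < u -> u != 0 -> 0 < power_slope u.
Proof.
move=> u1 u0; have x0 : 0 < 1 + u by lra.
have x1 : 1 + u != 1 by rewrite -subr_eq0 addrAC subrr add0r.
rewrite /power_slope; have [u_gt0|u_le0] := ltP 0 u.
  apply: divr_gt0 => //; rewrite subr_gt0.
  have := powR_bernoulli _ x0 x1; have : u < b * u by rewrite ltr_pMl.
  by lra.
have u_lt0 : u < 0 by rewrite lt_neqAle u0.
rewrite nmulr_lgt0 ?invr_lt0// subr_lt0.
rewrite /powR gt_eqF// -[ltRHS]lnK ?posrE// ltr_expR gtr_nMl//.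
by rewrite ln_lt0// x0/=; lra.
Qed.

(** The limit is the derivative of x^b at 1, minus 1. *)
Lemma power_slope_cvg : power_slope u @[u --> 0^'] --> b - 1.
Proof.
have [dp vp] := is_derive1_powR b (ltr01 : 0 < 1 :> R).
pose f : R -> R := fun x => x `^ b.
have : u^-1 *: (f (u *: 1 + 1) - f 1) @[u --> (0 : R)^'] --> 'D_1 f 1 by exact: dp.
rewrite vp /f !powR1 mulr1 => H.
have : u^-1 *: ((u *: 1 + 1) `^ b - 1) - 1 @[u --> (0 : R)^'] --> b - 1.
  by apply: cvgB H _; exact: cvg_cst.
apply: cvg_trans; apply: near_eq_cvg; near=> u.
have u0 : u != 0 by near: u; exact: nbhs_dnbhs_neq.
rewrite /power_slope /GRing.scale /= mulr1 [1 + u]addrC.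
by field.
Unshelve. all: by end_near. Qed.

(* Below [-1/2] the slope is continued linearly, which makes it strictly
   increasing on the whole line. *)
Definition extended_slope (u : R) : R :=
  power_slope (Num.max u (- 2^-1)) + Num.min (u + 2^-1) 0.

Lemma extended_slopeE u : - 2^-1 <= u -> extended_slope u = power_slope u.
Proof.
move=> u2; rewrite /extended_slope max_l// min_r ?addr0//; lra.
Qed.

Lemma extended_slope_increasing : increasing_off0 extended_slope.
Proof.
move=> u v u0 v0 uv; have [u2|u2] := leP (- 2^-1) u.
  by rewrite !extended_slopeE//; [apply: power_slope_lt => //|]; lra.
have -> : extended_slope u = power_slope (- 2^-1) + (u + 2^-1).
  by rewrite /extended_slope max_r ?min_l//; lra.
have [v2|v2] := leP v (- 2^-1).
  rewrite /extended_slope max_r// min_l//; last by lra.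
  by rewrite ltrD2l; lra.
rewrite extended_slopeE; last by lra.
have : power_slope (- 2^-1) < power_slope v by apply: power_slope_lt => //; lra.
by lra.
Qed.

Lemma extended_slope_cvg : extended_slope u @[u --> 0^'] --> b - 1.
Proof.
apply: cvg_trans power_slope_cvg; apply: near_eq_cvg; near=> u.
rewrite extended_slopeE//.
have : `|u| < 2^-1 by near: u; apply: dnbhs0_lt; lra.
by rewrite ltr_norml; lra.
Unshelve. all: by end_near. Qed.

End PowerSlope.

(** * Asymptotics for a function within a linear error of [L] *)

Section SecondDifference.
Variables (R : realType) (L L1 : R -> R) (b c : R).
Hypotheses (b1 : 1 < b).
Hypothesis L1_ge : forall t : R, 0 < t -> L t - c * t <= L1 t.
Hypothesis L1_le : forall t : R, 0 < t -> L1 t <= L t.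
Hypothesis L_superlinear : forall K : R, \forall t \near +oo, K * t <= L t.
Hypothesis L_regular : regularly_varying L b.

Let Fn (u t : R) : R := (L1 ((1 + u) * t) - (1 + u) * L1 t) / u.

Lemma near_L_gt0 : \forall t \near +oo, 0 < L t.
Proof.
near=> t; have t0 : 0 < t by near: t; exact: nbhs_pinfty_gt.
by apply: lt_le_trans t0 _; rewrite -[leLHS]mul1r; near: t; exact: L_superlinear.
Unshelve. all: by end_near. Qed.

Lemma sublinear_ratio_cvg : t / L t @[t --> +oo] --> (0 : R).
Proof.
apply/cvgrPdist_le => e e0; near=> t.
have t0 : 0 < t by near: t; exact: nbhs_pinfty_gt.
have Lt : 0 < L t by near: t; exact: near_L_gt0.
rewrite sub0r normrN ger0_norm; last by rewrite divr_ge0// ltW.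
rewrite ler_pdivrMr// mulrC -ler_pdivrMr// mulrC.
by near: t; exact: L_superlinear.
Unshelve. all: by end_near. Qed.

(** Squeezing: the linear error is negligible against the superlinear [L]. *)
Lemma perturbed_ratio_cvg (a : R) : 0 < a ->
  L1 (a * t) / L t @[t --> +oo] --> a `^ b.
Proof.
move=> a0.
apply: (@squeeze_cvgr _ _ _ _ (fun t => L (a * t) / L t - c * a * (t / L t))
  (fun t => L (a * t) / L t)); last exact: L_regular.
  near=> t; have t0 : 0 < t by near: t; exact: nbhs_pinfty_gt.
  have Lt : 0 < L t by near: t; exact: near_L_gt0.
  have at0 : 0 < a * t by rewrite mulr_gt0.
  rewrite mulrA -mulrBl !ler_pM2r ?invr_gt0// L1_le// andbT.
  by rewrite -mulrA L1_ge.
rewrite -[X in _ --> X]subr0; apply: cvgB; first exact: L_regular.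
rewrite -[X in _ --> X](mulr0 (c * a)); apply: cvgM; first exact: cvg_cst.
exact: sublinear_ratio_cvg.
Unshelve. all: by end_near. Qed.

Lemma second_difference_cvg (u : R) : -1 < u ->
  Fn u t / L t @[t --> +oo] --> power_slope R b u.
Proof.
move=> u1; have x0 : 0 < 1 + u by lra.
have one := perturbed_ratio_cvg 1 ltr01; rewrite powR1 in one.
have : (L1 ((1 + u) * t) / L t - (1 + u) * (L1 (1 * t) / L t)) / u @[t --> +oo] -->
    ((1 + u) `^ b - (1 + u) * 1) / u.
  apply: cvgM; last exact: cvg_cst.
  apply: cvgB; first exact: perturbed_ratio_cvg.
  by apply: cvgM; first exact: cvg_cst.
rewrite mulr1; apply: cvg_trans; apply: near_eq_cvg; near=> t.
by rewrite /Fn mul1r; ring.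
Unshelve. all: by end_near. Qed.

Lemma second_difference_equiv (u : R) : -1 < u -> u != 0 ->
  asymp_equiv (Fn u) (fun t => power_slope R b u * L t) /\
  asymp_equiv (fun t => Fn u (2 * t)) (fun t => 2 `^ b * power_slope R b u * L t).
Proof.
move=> u1 u0; have s0 := power_slope_gt0 R b b1 u u1 u0.
have s_neq0 : power_slope R b u != 0 by rewrite gt_eqF.
have p0 : 0 < 2 `^ b :> R by exact: powR_gt0.
have Fu := second_difference_cvg u u1.
split.
  rewrite /asymp_equiv -[X in _ --> X](divff s_neq0).
  have : Fn u t / L t / power_slope R b u @[t --> +oo] -->
      power_slope R b u / power_slope R b u by apply: cvgM Fu _; exact: cvg_cst.
  apply: cvg_trans; apply: near_eq_cvg; near=> t.
  have Lt : 0 < L t by near: t; exact: near_L_gt0.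
  by field; rewrite s_neq0 gt_eqF.
have ps_neq0 : 2 `^ b * power_slope R b u != 0 by rewrite mulf_neq0// gt_eqF.
have scale2 : (2 : R) * t @[t --> +oo] --> +oo.
  by apply: gt0_cvgMry => //; exact: cvg_id.
have Fu2 : Fn u (2 * t) / L (2 * t) @[t --> +oo] --> power_slope R b u.
  exact: (cvg_comp _ _ scale2 Fu).
rewrite /asymp_equiv -[X in _ --> X](divff ps_neq0).
(* Regular variation compares [L (2 * t)] with [L t], whence the factor 2^b. *)
have : Fn u (2 * t) / L (2 * t) * (L (2 * t) / L t) / (2 `^ b * power_slope R b u)
    @[t --> +oo] --> power_slope R b u * 2 `^ b / (2 `^ b * power_slope R b u).
  apply: cvgM; last exact: cvg_cst.
  by apply: cvgM Fu2 _; exact: L_regular.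
rewrite [power_slope R b u * _]mulrC.
apply: cvg_trans; apply: near_eq_cvg; near=> t.
have Lt : 0 < L t by near: t; exact: near_L_gt0.
have L2t : 0 < L (2 * t).
  near: t; apply: (near_pinfty_scale _ 2 (fun t => 0 < L t)) => //.
  exact: near_L_gt0.
by field; rewrite s_neq0 !gt_eqF.
Unshelve. all: by end_near. Qed.

(** The slopes at [2 * u] and [u] differ by a fixed amount of the sign of [u], and [L t / ln t]
    tends to infinity. The condition on [u] puts [2 * u] above -1. *)
Lemma second_difference_gap (u : R) : - 2^-1 < u -> u != 0 ->
  (Fn (2 * u) t - Fn u t) / (u * ln t) @[t --> +oo] --> +oo.
Proof.
move=> u1 u0.
have u20 : 2 * u != 0 by rewrite mulf_neq0.
pose g := (power_slope R b (2 * u) - power_slope R b u) / u.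
have g0 : 0 < g.
  rewrite /g; have [u_gt0|u_le0] := ltP 0 u.
    by rewrite divr_gt0// subr_gt0 power_slope_lt//; lra.
  have u_lt0 : u < 0 by rewrite lt_neqAle u0.
  by rewrite nmulr_lgt0 ?invr_lt0// subr_lt0 power_slope_lt//; lra.
have ratio : (Fn (2 * u) t / L t - Fn u t / L t) / u @[t --> +oo] --> g.
  apply: cvgM; last exact: cvg_cst.
  by apply: cvgB; apply: second_difference_cvg; lra.
apply/cvgryPge => A.
have half : 0 < g / 2 by rewrite divr_gt0.
move/cvgrPdist_le : ratio => /(_ _ half) ratio.
near=> t.
have t1 : 1 < t by near: t; exact: nbhs_pinfty_gt.
have Lt : 0 < L t by near: t; exact: near_L_gt0.
have lnt : 0 < ln t by rewrite ln_gt0.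
have lnle : ln t <= t.
  have t11 : -1 < t - 1 by lra.
  by have := le_ln1Dx t11; rewrite addrCA subrr addr0; lra.
(* The constant makes [g / 2 * L t] at least [|A| * t], which dominates [A * ln t]. *)
have Llarge : 2 * `|A| / g * t <= L t by near: t; exact: L_superlinear.
have : `|g - (Fn (2 * u) t / L t - Fn u t / L t) / u| <= g / 2 by near: t.
rewrite ler_norml => /andP[_ gap].
have {}gap : g / 2 <= (Fn (2 * u) t / L t - Fn u t / L t) / u by lra.
have -> : (Fn (2 * u) t - Fn u t) / (u * ln t) =
   (Fn (2 * u) t / L t - Fn u t / L t) / u * (L t / ln t).
  by field; rewrite u0 !gt_eqF.
apply: (@le_trans _ _ (g / 2 * (L t / ln t))); last first.
  by rewrite ler_wpM2r// divr_ge0// ltW.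
rewrite mulrA ler_pdivlMr//.
have : g / 2 * (2 * `|A| / g * t) <= g / 2 * L t by rewrite ler_pM2l.
apply: le_trans; rewrite (_ : g / 2 * _ = `|A| * t); last first.
  by field; rewrite gt_eqF.
apply: (@le_trans _ _ (`|A| * ln t)); first by rewrite ler_pM2r// ler_norm.
by rewrite ler_wpM2l.
Unshelve. all: by end_near. Qed.

End SecondDifference.

(** * Logarithmic form of the bounds on the averaged moment *)

Section MeanMomentBounds.
Variables (R : realType) (d : nat) (kappa : R).
Variables (disp : measure_display) (T : measurableType disp) (mu : probability T R).
Variables (w : Zd d -> {RV mu >-> (\bar R * R)%type}) (h : R -> R).
Hypotheses (kappa0 : 0 <= kappa) (hrange : forall o, field_range (sample w o)).
Hypothesis hid : identically_distributed w.
Hypothesis hexp : forall t : R, 0 <= t -> (mean_exp w t < +oo)%E.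
Hypothesis htail : forall x : R, 0 < x ->
  mu [set o | (x%:E < v0 w o)%E] = (expR (- h x))%:E.

Lemma H1_bounds (t : R) : 0 < t ->
  H w t - (2 * d)%:R * kappa * t <= H1 w kappa t <= H w t.
Proof.
move=> t0.
have mf := mean_exp_fin R d disp T mu w hexp t t0.
have m0 := mean_exp_gt0 R d disp T mu w h hrange hexp htail t t0.
have up := mean_first_moment_le R d kappa disp T mu w kappa0 hrange hid t t0.
have lo := mean_first_moment_ge R d kappa disp T mu w kappa0 hrange hid t t0.
have m1f : mean_first_moment w kappa t \is a fin_num.
  rewrite ge0_fin_numE; first exact: le_lt_trans up (hexp t (ltW t0)).
  by apply: le_trans lo; rewrite mule_ge0 ?lee_fin ?expR_ge0// mean_exp_ge0.
rewrite -(fineK mf) -(fineK m1f) -?EFinM !lee_fin in up lo.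
have m10 : 0 < fine (mean_first_moment w kappa t).
  by apply: lt_le_trans lo; rewrite mulr_gt0// expR_gt0.
apply/andP; split; last by rewrite /H1 /H ler_ln ?posrE.
by rewrite -ler_expR expRD /H1 /H !lnK ?posrE// mulrC -mulNr.
Qed.

End MeanMomentBounds.

Theorem proposition4 (R : realType) (d : nat) (kappa : R)
    (disp : measure_display) (T : measurableType disp) (mu : probability T R)
    (w : Zd d -> {RV mu >-> (\bar R * R)%type}) (h : R -> R) (rho : R)
    (hd : (1 <= d)%N) (hkappa : 0 <= kappa)
    (hrange : forall o, field_range (sample w o))
    (hiid : iid_environment w)
    (hnontriv : (mu [set o | v0 w o = -oo] < 1)%E)
    (hexp : forall t : R, 0 <= t -> (mean_exp w t < +oo)%E)
    (hsup : ess_sup mu (v0 w) = +oo%E)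
    (htail : forall x : R, 0 < x ->
       mu [set o | (x%:E < v0 w o)%E] = (expR (- h x))%:E)
    (hrho : 1 < rho)
    (hreg : regularly_varying h rho) :
  let gamma1 : R := 1 / (rho - 1) in
  let gamma2 : R := 2 `^ (rho / (rho - 1)) * (1 / (rho - 1)) in
  let J : R -> R := H w in
  (exists2 eps : R, 0 < eps & forall theta : R,
     theta != 0 -> `|theta| < eps ->
     (F w kappa (2 * theta) t - F w kappa theta t) / (theta * ln t)
       @[t --> +oo] --> +oo)
  /\
  (exists f1 f2 : R -> R,
     [/\ increasing_off0 f1, increasing_off0 f2,
         (exists2 eps : R, 0 < eps & forall theta : R,
            theta != 0 -> `|theta| < eps ->
            asymp_equiv (F w kappa theta) (fun t => f1 theta * J t) /\
            asymp_equiv (fun t => F w kappa theta (2 * t))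
                        (fun t => f2 theta * J t)),
         f1 theta @[theta --> 0^'] --> gamma1 &
         f2 theta @[theta --> 0^'] --> gamma2]).
Proof.
move=> gamma1 gamma2 J.
have [hid _] := hiid.
have beta1 := conjugate_index_gt1 R rho hrho.
set beta : R := rho / (rho - 1) in beta1.
have betaE : beta - 1 = gamma1.
  by rewrite /beta /gamma1; field; rewrite subr_eq0 gt_eqF.
have hbounds := H1_bounds R d kappa disp T mu w h hkappa hrange hid hexp htail.
have Hge := H_tail_ge R d disp T mu w h hrange hexp htail.
have Hle := H_le R d disp T mu w h hrange hexp htail.
have h0 := tail_exponent_ge0 R d disp T mu w h htail.
have Hsup := superlinear R (H w) h Hge.
have Hreg := conjugate_regularly_varying R (H w) h rho hrho hreg h0 Hge Hle.
have lo (t : R) : 0 < t -> H w t - (2 * d)%:R * kappa * t <= H1 w kappa t.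
  by move=> /hbounds /andP[].
have up (t : R) : 0 < t -> H1 w kappa t <= H w t.
  by move=> /hbounds /andP[].
split.
  (* Radius 1/2 keeps both [theta] and [2 * theta] above -1. *)
  exists 2^-1 => [|theta theta0]; first by rewrite invr_gt0.
  rewrite ltr_norml => /andP[theta1 _].
  exact: (second_difference_gap R (H w) (H1 w kappa) beta _ beta1 lo up Hsup Hreg).
(* The extension agrees with [power_slope] for [theta >= -1/2]; doubling [t] multiplies [J]
   asymptotically by 2^beta. *)
exists (extended_slope R beta), (fun u => 2 `^ beta * extended_slope R beta u).
have p0 : 0 < 2 `^ beta :> R by exact: powR_gt0.
have incr := extended_slope_increasing R beta beta1.
have lim1 := extended_slope_cvg R beta.
split.
- exact: incr.
- by move=> u v u0 v0 uv; rewrite ltr_pM2l// incr.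
- exists 2^-1 => [|theta theta0]; first by rewrite invr_gt0.
  rewrite ltr_norml => /andP[theta1 _].
  rewrite extended_slopeE; last exact: ltW.
  apply: (second_difference_equiv R (H w) (H1 w kappa) beta _ beta1 lo up Hsup Hreg) => //.
  by lra.
- by rewrite -betaE.
- by apply: cvgM; [exact: cvg_cst|rewrite -/gamma1 -betaE].
Qed.
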